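(* Let $L=L_k$ be an alternating link diagram with a marked maximal negative twist region with $k\ge 1$ crossings, and let $L_{k-1}$ be the diagram obtained from $L_k$ by replacing the marked twist region by a negative twist region with $k-1$ crossings. Then $$\langle L_k\rangle \doteq_{4k} \langle L_{k-1}\rangle .$$
   Context: Kauffman bracket: for a link diagram $D$ in $S^2$, $\langle D\rangle\in\mathbb{Z}[A^{\pm1}]$ is the unframed-normalized bracket determined by $\langle\text{empty diagram}\rangle=1$, $\langle D\sqcup\bigcirc\rangle=-(A^2+A^{-2})\langle D\rangle$, and $\langle\text{crossing}\rangle=A\langle\text{positive smoothing}\rangle+A^{-1}\langle\text{negative smoothing}\rangle$ at each crossing (positive smoothing = the standard $A$-smoothing, negative smoothing = the standard $A^{-1}$-smoothing). Twist regions: a negative twist region with $k$ crossings is a part of the diagram consisting of the two-strand tangle $\sigma^k$ (two strands twisted around each other, $k$ crossings stacked in a row), where each crossing $\sigma$ has the handedness for which its negative smoothing is the trivial tangle $1$ of two parallel strands and its positive smoothing is the cup-cap tangle $e$; so $\sigma=A\,e+A^{-1}\,1$ in the Temperley-Lieb algebra $TL_2$. It is maximal if it is not contained in a negative twist region with more crossings. $L_k$ denotes a diagram with one marked maximal negative twist region having $k$ crossings; for $j\ge 0$, $L_j$ denotes the diagram obtained by replacing the marked tangle $\sigma^k$ by $\sigma^j$, where for $j=0$ the region is replaced by two parallel strands $\sigma^0=1$ (the negative smoothing). Notation $\doteq_n$: for nonzero $P_1,P_2\in\mathbb{Z}[x^{-1}][[x]]$ write $P_1\doteq_n P_2$ if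 the lists of the first $n$ coefficients (coefficients of consecutive powers of $x$, zeros included, starting from the lowest-degree nonzero term of each series) agree up to one overall sign. E.g. $-x^{-4}+4x^{-3}-6+11x\doteq_5 1-4x+6x^4$. Here the variable is $x=A$. *)

(* Defs.v *)
From HB Require Import structures.
From mathcomp Require Import all_boot all_order all_algebra zify.
Set Implicit Arguments. Unset Strict Implicit. Unset Printing Implicit Defensive.
Import GRing.Theory.
Local Open Scope ring_scope.

(** * Link diagrams

   A diagram on the oriented sphere is encoded by a combinatorial map whose
   vertices are the crossings (degree 4) and some markers (degree 2) that only
   subdivide arcs; a crossing-free circle carries at least one marker.
   The darts (half-edges) at a crossing are numbered 0, 1, 2, 3 counterclockwise,
   the understrand being 0--2 and the overstrand 1--3. *)

Definition dart (C M : finType) : finType := (C * 'I_4 + M * bool)%type.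

Definition xdart (C M : finType) (c : C) (i : 'I_4) : dart C M := inl (c, i).
Definition mdart (C M : finType) (m : M) (b : bool) : dart C M := inr (m, b).
Arguments xdart {C M}.
Arguments mdart {C M}.

(* A split diagram is not determined by its combinatorial map: one must know
   which boundary walks bound a common region of the complement.  [join x y]
   asserts that the regions to the left of x and of y (both pointing away from
   their vertices) coincide; [same_region] below is the equivalence relation
   generated by [join] and by the boundary walks. *)
Record diagram := Diagram {
  crossing : finType;
  marker : finType;
  edge : dart crossing marker -> dart crossing marker;
  join : rel (dart crossing marker);
  edgeK : involutive edge;
  edge_neq : forall x, edge x != x }.

Notation darts D := (dart (crossing D) (marker D)).

Section DiagramTheory.
Variable D : diagram.
Implicit Types x y : darts D.

Definition clockwise x : darts D :=
  match x with
  | inl (c, i) => xdart c (i - 1)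
  | inr (m, b) => mdart m (~~ b)
  end.

(* The next dart along the boundary of the region to the left of x. *)
Definition face x : darts D := clockwise (edge x).

Definition region_step : rel (darts D) :=
  [rel x y | [|| y == face x, join x y | join y x]].
Definition same_region : rel (darts D) := connect region_step.

(* Gluing to the graph, for each region, a sphere with one hole per boundary
   walk gives a closed oriented surface, of Euler characteristic
   V - E + 2 R - F, where R and F are the numbers of regions and of boundary
   walks; and V - E = - #|crossing D|.  This surface has to be a sphere. *)
Definition surface_connected : bool :=
  [forall x, forall y,
    connect [rel x y | [|| y == edge x, y == clockwise x | region_step x y]] x y].

Definition planar : bool :=
  (#|darts D| == 0)%N ||
  (surface_connected &&
   (2 * n_comp region_step predT
      == #|crossing D| + fcard face predT + 2)%N).

(* x and y lie on a common arc between crossings (following the strand through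
   markers only). *)
Definition arc_step : rel (darts D) :=
  [rel x y | (y == edge x) ||
     match x with inl _ => false | inr (m, b) => y == mdart m (~~ b) end].
Definition same_arc : rel (darts D) := connect arc_step.

Definition alternating : Prop :=
  forall (c c' : crossing D) (i i' : 'I_4),
    xdart c i != xdart c' i' :> darts D -> same_arc (xdart c i) (xdart c' i') ->
    odd i != odd i'.

(** ** Negative twist regions

   The crossings of a horizontal twist region are listed from left to right,
   each with the rotation by 0 or 180 degrees that identifies its darts with the
   four ends of sigma: for [false], SE = 0, NE = 1, NW = 2 and SW = 3.  Then the
   negative smoothing, which joins 1--2 and 3--0 (see [smoothing]), is the
   tangle made of two horizontal strands, and the positive one is the cup-cap. *)

Definition end_dart (u : crossing D * bool) (p : 'I_4) : darts D :=
  xdart u.1 (if u.2 then p + 2 else p).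

(* The region to the left of x is an open disk, i.e. has one boundary walk. *)
Definition disk_region x : bool :=
  [forall y, same_region x y ==> fconnect face x y].

Definition twist_adjacent : rel (crossing D * bool) :=
  [rel u v | [&& same_arc (end_dart u 1) (end_dart v 2),
                 same_arc (end_dart u 0) (end_dart v 3)
               & disk_region (end_dart u 0)]].

Definition negative_twist_region (s : seq (crossing D * bool)) : bool :=
  uniq [seq u.1 | u <- s] && sorted twist_adjacent s.

Definition maximal_negative_twist_region (s : seq (crossing D * bool)) : Prop :=
  negative_twist_region s /\
  forall t, negative_twist_region t -> infix s t -> (size t <= size s)%N.

(** ** Kauffman bracket *)

(* Rotating the overstrand 1--3 counterclockwise sweeps the corners between 1
   and 2 and between 3 and 0; the positive smoothing (b = true) merges these two
   corners, so it joins 0--1 and 2--3. *)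
Definition smoothing (b : bool) (i : 'I_4) : 'I_4 :=
  if odd i == b then i - 1 else i + 1.

Definition state : finType := {ffun crossing D -> bool}.

Definition state_step (s : state) : rel (darts D) :=
  [rel x y | (y == edge x) ||
     match x with
     | inl (c, i) => y == xdart c (smoothing (s c) i)
     | inr (m, b) => y == mdart m (~~ b)
     end].

Definition loops (s : state) : nat := n_comp (state_step s) predT.

End DiagramTheory.

Definition A : {fraction {poly int}} := tofrac 'X.

Definition bracket (D : diagram) : {fraction {poly int}} :=
  \sum_(s : state D)
    (\prod_c (if s c then A else A^-1)) * (- (A ^+ 2 + A ^- 2)) ^+ loops s.

(** ** Comparison of the first n coefficients *)

(* The bracket lives in the subring Z[A, A^-1] of the fraction field of Z[A].
   p lists the coefficients of P starting from its lowest nonzero term. *)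
Definition coefficients_from_lowest (P : {fraction {poly int}}) (p : {poly int}) :=
  p`_0 != 0 /\ exists d : int, P = A ^ d * tofrac p.

Definition doteq (n : nat) (P Q : {fraction {poly int}}) : Prop :=
  exists p q : {poly int},
    [/\ coefficients_from_lowest P p, coefficients_from_lowest Q q
      & exists e : bool, forall i, (i < n)%N -> p`_i = (-1) ^+ e * q`_i].

(** * Tangles with four ends *)

(* The ends are placed on a circle, in counterclockwise order: SE = 0, NE = 1,
   NW = 2, SW = 3.  The tangle may lie on either side of that circle.  The dart at
   an end points into the tangle. *)
Definition tdart (C M : finType) : finType := (dart C M + 'I_4)%type.

Record tangle := Tangle {
  tcrossing : finType;
  tmarker : finType;
  tedge : tdart tcrossing tmarker -> tdart tcrossing tmarker;
  tjoin : rel (tdart tcrossing tmarker);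
  tedgeK : involutive tedge;
  tedge_neq : forall x, tedge x != x }.

Section Glue.
Variables T S : tangle.

(* Each point of the circle becomes a marker, whose dart [false] points towards
   T and whose dart [true] points towards S. *)
Definition gcrossing : finType := (tcrossing T + tcrossing S)%type.
Definition gmarker : finType := (tmarker T + tmarker S + 'I_4)%type.
Definition gdart := dart gcrossing gmarker.

Definition outer (x : tdart (tcrossing T) (tmarker T)) : gdart :=
  match x with
  | inl (inl (c, i)) => xdart (inl c) i
  | inl (inr (m, b)) => mdart (inl (inl m)) b
  | inr p => mdart (inr p) false
  end.

Definition inner (x : tdart (tcrossing S) (tmarker S)) : gdart :=
  match x with
  | inl (inl (c, i)) => xdart (inr c) i
  | inl (inr (m, b)) => mdart (inl (inr m)) b
  | inr p => mdart (inr p) true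
  end.

Definition unglue (x : gdart) :
    tdart (tcrossing T) (tmarker T) + tdart (tcrossing S) (tmarker S) :=
  match x with
  | inl (inl c, i) => inl (inl (xdart c i))
  | inl (inr c, i) => inr (inl (xdart c i))
  | inr (inl (inl m), b) => inl (inl (mdart m b))
  | inr (inl (inr m), b) => inr (inl (mdart m b))
  | inr (inr p, b) => if b then inr (inr p) else inl (inr p)
  end.

Definition gedge (x : gdart) : gdart :=
  match unglue x with
  | inl y => outer (tedge y)
  | inr z => inner (tedge z)
  end.

(* The arc of the circle between the ends p and p + 1 lies in a single region,
   with S inside the circle and T outside. *)
Definition gjoin : rel gdart := fun x y =>
  match unglue x, unglue y with
  | inl x', inl y' => tjoin x' y'
  | inr x', inr y' => tjoin x' y'
  | inl (inr p), inr (inr q) => q == p + 1 :> 'I_4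
  | _, _ => false
  end.

Lemma outerK x : unglue (outer x) = inl x.
Proof. by case: x => [[[c i]|[m b]]|p]. Qed.

Lemma innerK x : unglue (inner x) = inr x.
Proof. by case: x => [[[c i]|[m b]]|p]. Qed.

Lemma unglueK x :
  match unglue x with inl y => outer y | inr z => inner z end = x.
Proof. by case: x => [[[c|c] i]|[[[m|m]|p] []]]. Qed.

Lemma gedgeK : involutive gedge.
Proof.
move=> x; rewrite -{2}[x]unglueK /gedge; case: (unglue x) => y.
  by rewrite outerK tedgeK.
by rewrite innerK tedgeK.
Qed.

Lemma gedge_neq x : gedge x != x.
Proof.
rewrite -[X in _ != X]unglueK /gedge; case: (unglue x) => y; apply/eqP.
  by move/(congr1 unglue); rewrite !outerK => -[] /eqP; rewrite (negPf (tedge_neq y)).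
by move/(congr1 unglue); rewrite !innerK => -[] /eqP; rewrite (negPf (tedge_neq y)).
Qed.

Definition glue : diagram := @Diagram gcrossing gmarker gedge gjoin gedgeK gedge_neq.

End Glue.

(** ** The twist tangles *)

(* The crossings of sigma^k are numbered 0, ..., k - 1 from left to right; the
   right ends of each one (0 and 1) are joined to the left ends (3 and 2
   respectively) of the next one.  For k = 0 the ends 1--2 and 0--3 are joined. *)
Definition twist_edge k (x : tdart 'I_k void) : tdart 'I_k void :=
  match x with
  | inl (inl (i, p)) =>
      if (p < 2)%N then
        if insub i.+1 is Some j then inl (xdart j (rev_ord p)) else inr p
      else
        if (0 < i)%N then
          if insub i.-1 is Some j then inl (xdart j (rev_ord p)) else inr p
        else inr p
  | inl (inr (m, _)) => match m with end
  | inr p =>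
      if insub (if (p < 2)%N then k.-1 else 0%N) is Some j
      then inl (xdart j p) else inr (rev_ord p)
  end.

Lemma rev_ord4_lt2 (p : 'I_4) : (rev_ord p < 2)%N = ~~ (p < 2)%N.
Proof. by case: p => [[|[|[|[|p]]]] hp]. Qed.

Lemma rev_ord4_neq (p : 'I_4) : rev_ord p != p.
Proof. by case: p => [[|[|[|[|p]]]] hp]. Qed.

Lemma twist_edgeK k : involutive (@twist_edge k).
Proof.
case=> [[[i p]|[[] //]]|p] /=.
- case: ifP => hp.
    case: insubP => [j _ hj|hk] /=.
      rewrite rev_ord4_lt2 hp /= hj /= rev_ordK.
      by case: insubP => [j' _ /val_inj->|]; rewrite ?ltn_ord.
    rewrite hp; have -> : k.-1 = i by case: k i hk => [|k] i; [case: i | have := ltn_ord i; lia].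
    by case: insubP => [j' _ /val_inj->|]; rewrite ?ltn_ord.
  case: ifP => hi.
    case: insubP => [j _ hj|]; last by have := ltn_ord i; lia.
    rewrite /= rev_ord4_lt2 hp /= rev_ordK hj prednK //.
    by case: insubP => [j' _ /val_inj->|]; rewrite ?ltn_ord.
  rewrite /= hp; case: insubP => [j _ hj|]; last by have := ltn_ord i; lia.
  by do 2!congr inl; congr (_, _); apply: val_inj; rewrite /= hj; lia.
- case: insubP => [j hk hj|hk] /=.
    case: ifP hj hk => hp hj hk; last by rewrite hj.
    rewrite hj; case: insubP => // j' h' _; lia.
  rewrite rev_ord4_lt2 rev_ordK.
  case: insubP => // j' h' _; have := ltn_ord j'; move: hk h'; case: ifP => _ /=; lia.
Qed.

Lemma twist_edge_neq k (x : tdart 'I_k void) : twist_edge x != x.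
Proof.
have E (j i : 'I_k) (p q : 'I_4) : q != p ->
    (inl (xdart j q) : tdart 'I_k void) != inl (xdart i p).
  by apply: contraNneq => -[_ ->].
case: x => [[[i p]|[[] //]]|p] /=.
  by case: ifP => _; [|case: ifP => _ //]; case: insubP => // j _ _;
    apply/E/rev_ord4_neq.
case: insubP => // _; apply/eqP => -[] /eqP.
by rewrite (negPf (rev_ord4_neq p)).
Qed.

Definition twist (k : nat) : tangle :=
  @Tangle 'I_k void (@twist_edge k) (fun _ _ => false)
    (@twist_edgeK k) (@twist_edge_neq k).

(* L_k, for the complementary tangle T. *)
Definition L_ (T : tangle) (k : nat) : diagram := glue T (twist k).

Definition marked_region (T : tangle) (k : nat) : seq (crossing (L_ T k) * bool) :=
  [seq (inr i, false) | i <- enum 'I_k].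

(** * The defining rules of the bracket *)

Lemma smoothingK b : involutive (smoothing b).
Proof. by case: b => -[[|[|[|[|i]]]] hi] //; apply: val_inj. Qed.

Lemma smoothing_neq b i : smoothing b i != i.
Proof. by case: b; case: i => -[|[|[|[|i]]]] hi. Qed.

Lemma state_step_connect_sym D (s : state D) : connect_sym (state_step s).
Proof.
apply: sym_connect_sym => x y; rewrite /state_step /=; congr (_ || _).
  by apply/eqP/eqP => ->; rewrite edgeK.
case: x y => [[c i]|[m b]] [[c' i']|[m' b']]; apply/eqP/eqP => // -[-> ->].
- by rewrite smoothingK.
- by rewrite smoothingK.
- by rewrite negbK.
- by rewrite negbK.
Qed.

(* <empty diagram> = 1 *)
Lemma bracket_empty D : #|darts D| = 0%N -> bracket D = 1.
Proof.
move=> D0.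
have noc (c : crossing D) : False.
  by move: D0; rewrite (cardD1 (xdart c 0 : darts D)).
have no_loop (s : state D) : loops s = 0%N.
  by apply: eq_card0 => x; have := card0_eq D0 x; rewrite inE.
have eqs (s s' : state D) : s = s' by apply/ffunP => c; case: (noc c).
rewrite /bracket (big_pred1 [ffun => true]) => [|s]; last first.
  by rewrite (eqs s [ffun => true]) /= eqxx.
by rewrite no_loop expr0 mulr1 big1 // => c; case: (noc c).
Qed.

(* <D, circle> = - (A^2 + A^-2) <D>, wherever the circle is placed *)
Section AddCircle.
Variable D : diagram.

Definition cdart := dart (crossing D) (marker D + unit)%type.

Definition old_dart (x : darts D) : cdart :=
  match x with
  | inl (c, i) => xdart c i
  | inr (m, b) => mdart (inl m) b
  end.

Definition cedge (x : cdart) : cdart :=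
  match x with
  | inl (c, i) => old_dart (edge (xdart c i))
  | inr (inl m, b) => old_dart (edge (mdart m b))
  | inr (inr _, b) => mdart (inr tt) (~~ b)
  end.

Lemma cedge_old x : cedge (old_dart x) = old_dart (edge x).
Proof. by case: x => [[c i]|[m b]]. Qed.

Lemma old_dart_inj : injective old_dart.
Proof. by move=> [[c i]|[m b]] [[c' i']|[m' b']] //= [-> ->]. Qed.

Lemma cdartP (x : cdart) :
  (exists y, x = old_dart y) \/ exists b, x = mdart (inr tt) b.
Proof.
case: x => [[c i]|[[m|[]] b]]; last by right; exists b.
  by left; exists (xdart c i).
by left; exists (mdart m b).
Qed.

Lemma cedgeK : involutive cedge.
Proof.
by move=> x; case: (cdartP x) => [[y ->]|[b ->]]; rewrite ?cedge_old ?edgeK //= negbK.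
Qed.

Lemma cedge_neq x : cedge x != x.
Proof.
case: (cdartP x) => [[y ->]|[[] ->]] //.
by rewrite cedge_old (inj_eq old_dart_inj) edge_neq.
Qed.

Definition add_circle (J : rel cdart) : diagram :=
  @Diagram (crossing D) (marker D + unit)%type cedge J cedgeK cedge_neq.

Lemma bracket_add_circle J :
  bracket (add_circle J) = - (A ^+ 2 + A ^- 2) * bracket D.
Proof.
rewrite /bracket mulr_sumr; apply: eq_bigr => s _.
rewrite mulrCA -exprS; congr (_ * _ ^+ _).
pose e := @state_step (add_circle J) s.
pose a := [pred x : cdart | if x is inr (inr _, _) then false else true].
have esym : connect_sym e by exact: state_step_connect_sym.
have step x y : e (old_dart x) (old_dart y) = @state_step D s x y.
  rewrite /e /state_step /= cedge_old (inj_eq old_dart_inj); congr (_ || _).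
  by case: x y => [[c i]|[m b]] [[c' i']|[m' b']].
have acl : closed e a.
  move=> x y; case: (cdartP x) => [[u ->]|[b ->]]; rewrite /e /state_step /=.
    rewrite cedge_old => /orP[/eqP->|]; first by case: u (edge u) => [[? ?]|[? ?]] [[? ?]|[? ?]].
    by case: u => [[? ?]|[? ?]] /= /eqP->.
  by case/orP => /eqP->.
rewrite -addn1 {1}/loops -/e (n_compC a).
suff -> : n_comp e a = @loops D s.
  congr (_ + _)%N.
  rewrite -(n_comp_connect esym (mdart (inr tt) true)); apply: eq_n_comp_r => x.
  rewrite !inE; apply/idP/idP => [|cx].
    case: (cdartP x) => [[u ->]|[[] ->]] ; first by case: u => [[? ?]|[? ?]].
      by move=> _; exact: connect0.
    by move=> _; apply: connect1; rewrite /e /state_step /= ?eqxx.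
  by have := closed_connect acl cx; rewrite !inE => <-.
rewrite (adjunction_n_comp old_dart esym (@state_step_connect_sym D s) acl) //.
  by apply: eq_n_comp_r => x; rewrite !inE; case: x => [[? ?]|[? ?]].
apply: strict_adjunction => //.
- exact: (@state_step_connect_sym D s).
- exact: old_dart_inj.
- apply/subsetP => x; rewrite inE; case: (cdartP x) => [[u ->] _|[b ->]] //.
  exact: codom_f.
Qed.

End AddCircle.

(* <sigma> = A <e> + A^-1 <1>, inside any tangle T *)
Definition cupcap_edge (x : tdart void void) : tdart void void :=
  match x with
  | inl (inl (c, _)) => match c with end
  | inl (inr (m, _)) => match m with end
  | inr p => inr (smoothing true p)
  end.

Lemma cupcap_edgeK : involutive cupcap_edge.
Proof. by move=> [[[[]]|[[]]]|p] //=; rewrite smoothingK. Qed.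

Lemma cupcap_edge_neq x : cupcap_edge x != x.
Proof.
by case: x => [[[[]]|[[]]]|p] //=; apply/eqP=> -[] /eqP; rewrite (negPf (smoothing_neq _ _)).
Qed.

Definition cupcap : tangle :=
  @Tangle void void cupcap_edge (fun _ _ => false) cupcap_edgeK cupcap_edge_neq.

Lemma n_comp_retract (U V : finType) (e : rel U) (e' : rel V)
    (h : V -> U) (r : U -> V) :
  connect_sym e -> connect_sym e' -> cancel h r ->
  (forall x, connect e x (h (r x))) ->
  (forall x y, e x y -> connect e' (r x) (r y)) ->
  (forall x y, e' x y -> connect e (h x) (h y)) ->
  n_comp e predT = n_comp e' predT.
Proof.
move=> es es' hK rK re he.
have lift (W Z : finType) (f : rel W) (g : rel Z) (k : W -> Z) :
    (forall x y, f x y -> connect g (k x) (k y)) ->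
    forall x y, connect f x y -> connect g (k x) (k y).
  move=> fg x y /connectP[p]; elim: p x => [|z p IH] x /=; first by move=> _ ->.
  by case/andP => /fg xz /IH{}IH /IH; apply: connect_trans.
rewrite (adjunction_n_comp h es es' (a := predT)) //.
split=> [x _|x y _]; first by exists (r x); apply: rK.
apply/idP/idP => [|/(lift _ _ _ _ _ re)]; first exact: lift he x y.
by rewrite !hK.
Qed.

Section Skein.
Variable T : tangle.

Definition extend S (s : {ffun tcrossing T -> bool}) (b : bool) : state (glue T S) :=
  [ffun c => match c with inl c => s c | inr _ => b end].

Section Resolve.
Variables (S : tangle) (b : bool).
Hypotheses (noc : tcrossing S -> False) (nom : tmarker S -> False).
Hypothesis (edgeS : forall p, @tedge S (inr p) = inr (smoothing b p)).

Local Notation X := (glue T (twist 1)).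
Local Notation Y := (glue T S).

Definition to_cross (x : darts Y) : darts X :=
  match x with
  | inl (inl c, i) => xdart (inl c) i
  | inl (inr c, i) => match noc c with end
  | inr (inl (inl m), b) => mdart (inl (inl m)) b
  | inr (inl (inr m), b) => match nom m with end
  | inr (inr p, b) => mdart (inr p) b
  end.

Definition of_cross (x : darts X) : darts Y :=
  match x with
  | inl (inl c, i) => xdart (inl c) i
  | inl (inr c, i) => mdart (inr i) true
  | inr (inl (inl m), b) => mdart (inl (inl m)) b
  | inr (inl (inr m), b) => match m with end
  | inr (inr p, b) => mdart (inr p) b
  end.

Lemma twist1_end p : @twist_edge 1 (inr p) = inl (xdart ord0 p).
Proof.
rewrite /=; case: insubP => [j _ _|]; first by rewrite (ord1 j).
by case: ifP.
Qed.

Lemma twist1_crossing i p : @twist_edge 1 (inl (xdart i p)) = inr p.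
Proof. by rewrite (ord1 i) -twist1_end twist_edgeK. Qed.

Lemma edge_cross i p : edge (xdart (inr i) p : darts X) = mdart (inr p) true.
Proof. exact: (congr1 (@inner T (twist 1)) (twist1_crossing i p)). Qed.

Lemma edge_port p : edge (mdart (inr p) true : darts X) = xdart (inr ord0) p.
Proof. exact: (congr1 (@inner T (twist 1)) (twist1_end p)). Qed.

Lemma edge_port_resolved p :
  edge (mdart (inr p) true : darts Y) = mdart (inr (smoothing b p)) true.
Proof. exact: (congr1 (@inner T S) (edgeS p)). Qed.

Lemma edge_outer S' x : edge (@outer T S' x : darts (glue T S')) = outer S' (tedge x).
Proof. by rewrite /= /gedge outerK. Qed.

Lemma outer_to_cross x : to_cross (@outer T S x) = @outer T (twist 1) x.
Proof. by case: x => [[[c i]|[m b']]|p]. Qed.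

Lemma outer_of_cross x : of_cross (@outer T (twist 1) x) = @outer T S x.
Proof. by case: x => [[[c i]|[m b']]|p]. Qed.

Lemma loops_resolve s : loops (extend (twist 1) s b) = loops (extend S s b).
Proof.
have sym := state_step_connect_sym.
set sX := extend _ s b; set sY := extend _ s b.
have cX (i : 'I_1) p : connect (state_step sX) (xdart (inr i) p) (mdart (inr p) true).
  by apply: connect1; apply/orP; left; rewrite edge_cross.
have out S' (x : darts (glue T S')) : (exists y, x = outer S' y) \/ exists z, x = inner T z.
  by rewrite -[x]unglueK; case: (unglue x) => y; [left|right]; exists y.
apply: (@n_comp_retract _ _ _ _ to_cross of_cross (sym _ _) (sym _ _)).
- by move=> [[[c|c] i]|[[[m|m]|p] b']].
- move=> [[[c|c] i]|[[[m|[]]|p] b']];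
    [exact: connect0 | exact: cX | exact: connect0 | exact: connect0].
- move=> x y /orP[/eqP->|].
    case: (out _ x) => [[u ->]|[[[[i p]|[[]]]|p] ->]].
    + rewrite edge_outer !outer_of_cross; apply: connect1; apply/orP; left.
      by rewrite edge_outer.
    + by rewrite edge_cross; exact: connect0.
    + by rewrite edge_port; exact: connect0.
  case: x => [[[c|c] i]|[[[m|[]]|p] b']] /eqP->; apply: connect1; apply/orP.
  + by right; rewrite /= !ffunE.
  + by left; rewrite edge_port_resolved /= ffunE.
  + by right => /=.
  + by right => /=.
- move=> x y /orP[/eqP->|].
    case: (out _ x) => [[u ->]|[[[[c i]|[m ?]]|p] ->]].
    + rewrite edge_outer !outer_to_cross; apply: connect1; apply/orP; left.
      by rewrite edge_outer.
    + by case: (noc c).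
    + by case: (nom m).
    + rewrite edge_port_resolved.
      apply: (connect_trans (y := xdart (inr ord0) p)); first by rewrite (sym X sX); exact: cX.
      apply: connect_trans (cX _ _); apply: connect1; apply/orP; right.
      by rewrite /= ffunE.
  case: x => [[[c|c] i]|[[[m|m]|p] b']] /eqP->.
  + by apply: connect1; apply/orP; right; rewrite /= !ffunE.
  + by case: (noc c).
  + by apply: connect1; apply/orP; right => /=.
  + by case: (nom m).
  + by apply: connect1; apply/orP; right => /=.
Qed.

Lemma bracket_resolve :
  bracket Y = \sum_(s : {ffun tcrossing T -> bool})
    (\prod_c (if s c then A else A^-1))
      * (- (A ^+ 2 + A ^- 2)) ^+ loops (extend (twist 1) s b).
Proof.
rewrite /bracket (reindex (fun s => extend S s b)) /=; last first.
  exists (fun s : state Y => [ffun c => s (inl c)]) => s _; apply/ffunP => c.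
    by rewrite !ffunE.
  by rewrite ffunE; case: c => c; [rewrite ffunE | case: (noc c)].
apply: eq_bigr => s _; rewrite loops_resolve; congr (_ * _).
rewrite big_sumType /= [X in _ * X]big1 ?mulr1; last by move=> c; case: (noc c).
by apply: eq_bigr => c _; rewrite ffunE.
Qed.

End Resolve.

Lemma bracket_skein :
  bracket (glue T (twist 1))
    = A * bracket (glue T cupcap) + A^-1 * bracket (glue T (twist 0)).
Proof.
have twist0_edge p : @tedge (twist 0) (inr p) = inr (smoothing false p).
  rewrite /=; case: insubP => [[] //|_]; congr inr.
  by case: p => -[|[|[|[|p]]]] hp //; apply: val_inj.
have no0 : 'I_0 -> False by case.
rewrite (@bracket_resolve cupcap true) //; try by case.
rewrite (@bracket_resolve (twist 0) false) //; try by case.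
rewrite !mulr_sumr -big_split /=.
pose f (u : {ffun tcrossing T -> bool} * bool) := extend (twist 1) u.1 u.2.
rewrite /bracket (reindex f) /=; last first.
  exists (fun s : state (glue T (twist 1)) => ([ffun c => s (inl c)], s (inr ord0))).
    by move=> [s b] _; rewrite /f /=; congr (_, _); [apply/ffunP => c|]; rewrite !ffunE.
  move=> s _; apply/ffunP => c; rewrite /f !ffunE.
  by case: c => c; [rewrite ffunE | rewrite (ord1 c)].
rewrite -(pair_bigA _ (fun s b => \prod_c (if f (s, b) c then A else A^-1)
  * (- (A ^+ 2 + A ^- 2)) ^+ loops (f (s, b)))) /=.
apply: eq_bigr => s _; rewrite big_bool /f /=.
have w b : \prod_c (if extend (twist 1) s b c then A else A^-1)
    = (if b then A else A^-1) * \prod_c (if s c then A else A^-1).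
  rewrite big_sumType mulrC /= big_ord1 ffunE; congr (_ * _).
  by apply: eq_bigr => c _; rewrite ffunE.
by rewrite !w !mulrA.
Qed.

End Skein.

(* Main.v *)
Require Import Defs.
From HB Require Import structures.
From mathcomp Require Import all_boot all_order all_algebra all_fingroup zify ring.

(* Put delta = - (A^2 + A^-2), and let L_0 and L_e be the diagrams obtained from
   L_k by replacing the twist region by two parallel strands and by the cup-cap.
   Expanding the twist region gives
     A^k <L_k> = <L_0> + A^2 (1 - A^4 + ... + (- A^4)^(k-1)) <L_e>,
   so A^k <L_k> and A^(k-1) <L_(k-1)> differ by +- A^(4k-2) <L_e>, and the point is
   to locate the lowest terms of <L_0> and of <L_e>.

   Let c be a crossing of the alternating diagram L_k.  If the two arcs of the
   negative smoothing at c lie on different curves of the all-negative state, then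
   switching c merges these curves.  Otherwise, since the curves of that state are
   the boundary walks of faces, the same walk passes c twice; splitting the vertex c
   along that walk adds one vertex and one face, so by Euler's formula the split
   graph has one more component.  Then, in every state, switching c from negative
   to positive creates one more curve: c is nugatory.

   Summing over the smoothings of the nugatory crossings outside the twist region
   only contributes a power of - A^4.  In what remains, the all-negative state is
   the only one that reaches the lowest degree M of <L_0>.  If the crossings of the
   twist region are not nugatory, <L_e> starts at degree M + 2 or later; if they
   are, <L_e> = delta <L_0> and <L_k> = - A^3 <L_(k-1)>. *)

Set Implicit Arguments. Unset Strict Implicit. Unset Printing Implicit Defensive.
Import GRing.Theory.

(** * Components of finite relations *)

Section Components.
Variable T : finType.
Implicit Types (e : rel T) (l : seq (T * T)) (x y u v : T).

(** Relations are generated by lists of pairs so that components can be counted by adding one pair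
    at a time. *)
Definition pairs l : rel T := [rel u v | ((u, v) \in l) || ((v, u) \in l)].

Lemma pairs_sym l : connect_sym (pairs l).
Proof. by apply: sym_connect_sym => u v; rewrite /pairs /= orbC. Qed.

Lemma pairs_connect l u v : (u, v) \in l -> connect (pairs l) u v.
Proof. by move=> uv; apply: connect1; rewrite /pairs /= uv. Qed.

Lemma connect_pairs l e : connect_sym e ->
  (forall u v, (u, v) \in l -> connect e u v) -> subrel (connect (pairs l)) (connect e).
Proof.
move=> es le; apply: connect_sub => u v; rewrite /pairs /= => /orP[/le //|/le].
by rewrite es.
Qed.

Lemma pairs_subset l l' : {subset l <= l'} -> subrel (connect (pairs l)) (connect (pairs l')).
Proof.
move=> ll'; apply: connect_pairs (@pairs_sym _) _ => u v /ll'; exact: pairs_connect.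
Qed.

Lemma eq_connect_subrel e e' :
  (forall u v, e u v -> connect e' u v) -> (forall u v, e' u v -> connect e u v) ->
  connect e =2 connect e'.
Proof.
by move=> /connect_sub ee' /connect_sub e'e u v; apply/idP/idP => [/ee'|/e'e].
Qed.

Definition rel_pairs e : seq (T * T) := [seq p <- enum {: T * T} | e p.1 p.2].

Lemma mem_rel_pairs e u v : ((u, v) \in rel_pairs e) = e u v.
Proof. by rewrite mem_filter mem_enum andbT. Qed.

Lemma connect_rel_pairs e : connect_sym e -> connect (pairs (rel_pairs e)) =2 connect e.
Proof.
move=> es; apply: eq_connect_subrel => u v.
  rewrite /pairs /= !mem_rel_pairs.
  by case/orP => uv; [|rewrite es]; apply: connect1.
by move=> uv; apply: pairs_connect; rewrite mem_rel_pairs.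
Qed.

Lemma connect_cons l x y u v :
  connect (pairs ((x, y) :: l)) u v =
  connect (pairs l) u v ||
  (connect (pairs l) u x || connect (pairs l) u y)
    && (connect (pairs l) v x || connect (pairs l) v y).
Proof.
have sub : subrel (connect (pairs l)) (connect (pairs ((x, y) :: l))).
  by apply: pairs_subset => p lp; rewrite inE lp orbT.
have sym := pairs_sym.
have xy : connect (pairs ((x, y) :: l)) x y by apply: pairs_connect; exact: mem_head.
apply/idP/idP => [|/orP[/sub //|/andP[ux vx]]]; last first.
  have to_x w : connect (pairs l) w x || connect (pairs l) w y ->
      connect (pairs ((x, y) :: l)) w x.
    by case/orP => /sub // wy; apply: connect_trans wy _; rewrite sym.
  by apply: connect_trans (to_x _ ux) _; rewrite sym; exact: to_x.
case: (boolP (connect (pairs l) u v)) => //= nuv.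
pose a := [pred w | connect (pairs l) u w ||
  (connect (pairs l) u x || connect (pairs l) u y)
    && (connect (pairs l) w x || connect (pairs l) w y)].
(* A new pair can only merge the classes of its two ends, so this candidate for the class of [u] is
   already stable. *)
have acl : closed (pairs ((x, y) :: l)) a.
  apply: intro_closed => // w z.
  rewrite {1}/pairs /= !inE.
  have st : pairs l w z -> w \in a -> z \in a.
    move=> wz; have cwz := connect1 wz.
    rewrite !inE !(sym l z) -!(same_connect_r (sym l) cwz) => /orP[->//|/andP[-> ]].
    by rewrite !(sym l _ w) => ->; rewrite orbT.
  move=> /orP[/orP[/eqP[-> ->]|wz]|/orP[/eqP[-> ->]|wz]];
   last (by apply: st; rewrite /pairs /= wz orbT); try (by apply: st; rewrite /pairs /= wz);
   rewrite !connect0 ?orbT ?andbT => /orP[->|->] //; by rewrite ?orbT.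
by move=> uv; have := closed_connect acl uv; rewrite !inE connect0 (negPf nuv).
Qed.

Lemma eq_root e e' x : connect e x =1 connect e' x -> fingraph.root e x = fingraph.root e' x.
Proof. by move=> ee'; rewrite /fingraph.root (eq_pick ee'). Qed.

Lemma n_comp_cons l x y :
  n_comp (pairs ((x, y) :: l)) predT + ~~ connect (pairs l) x y = n_comp (pairs l) predT.
Proof.
have sym := pairs_sym.
case: (boolP (connect _ x y)) => [xy|nxy]; rewrite ?addn0.
  apply: eq_n_comp => u v; rewrite connect_cons; case: (boolP (connect _ u v)) => //= nuv.
  rewrite -!(same_connect_r (sym l) xy) !orbb; apply: contraNF nuv => /andP[ux vx].
  by apply: connect_trans ux _; rewrite sym.
pose a := [pred w | connect (pairs l) w x || connect (pairs l) w y].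
rewrite (n_compC a) [RHS](n_compC a) addnAC; congr (_ + _).
  have -> : n_comp (pairs ((x, y) :: l)) a = 1.
    rewrite -(n_comp_connect (sym ((x, y) :: l)) x); apply: eq_n_comp_r => w.
    by rewrite !inE connect_cons connect0 /= (sym l x); case: (connect (pairs l) w x).
  rewrite /n_comp_mem (eq_card (B := pred2 (fingraph.root (pairs l) x) (fingraph.root (pairs l) y))).
    by rewrite card2 (root_connect (sym l)) nxy.
  move=> w; rewrite !inE /roots.
  rewrite -!(root_connect (sym l)); apply/andP/orP => [[/eqP-> /orP//]|].
  by case=> /eqP->; rewrite !root_root // eqxx ?orbT.
apply: eq_card => w; rewrite !inE; case: (boolP (_ || _)) => //= wa; rewrite ?andbF // !andbT.
rewrite /roots; congr (_ == _); apply: eq_root => v.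
by rewrite connect_cons (negPf wa) orbF.
Qed.

(** A pair of [l] that merges two classes over the coarser [l2] also merges two over [l1], so the
    drop is at least as large on the finer side. *)
Lemma n_comp_submodular l1 l2 l :
  subrel (connect (pairs l1)) (connect (pairs l2)) ->
  n_comp (pairs l2) predT + n_comp (pairs (l ++ l1)) predT
    <= n_comp (pairs l1) predT + n_comp (pairs (l ++ l2)) predT.
Proof.
move=> l12; elim: l => [|[x y] l IH]; first by rewrite addnC.
rewrite !cat_cons; have:= n_comp_cons (l ++ l1) x y; have:= n_comp_cons (l ++ l2) x y.
have : connect (pairs (l ++ l1)) x y -> connect (pairs (l ++ l2)) x y.
  apply: connect_pairs (@pairs_sym _) _ x y => u v; rewrite mem_cat => /orP[uv|/pairs_connect /l12].
    by apply: pairs_connect; rewrite mem_cat uv.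
  by apply: pairs_subset => p; rewrite mem_cat orbC => ->.
case: (connect _ x y) => [/(_ isT) ->|_]; last case: (connect _ x y);
  rewrite /= ?addn0 ?addn1; lia.
Qed.

(** A function constant on components takes at most one value on each; this yields lower bounds for
    component counts. *)
Lemma leq_codom_n_comp (W : finType) e (h : T -> W) :
  connect_sym e -> (forall u v, e u v -> h u = h v) -> #|codom h| <= n_comp e predT.
Proof.
move=> es he.
have hc u v : connect e u v -> h u = h v.
  by case/connectP => p; elim: p u => [|w p IH] u /=; [move=> _ -> | case/andP => /he -> /IH].
have -> : n_comp e predT = #|roots e| by apply: eq_card => u; rewrite !inE andbT.
apply: leq_trans (leq_image_card h (roots e)).
apply: subset_leq_card; apply/subsetP => w /codomP[u ->].
by rewrite (hc _ _ (connect_root e u)); apply: image_f; exact: roots_root.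
Qed.

Lemma even_involution (f : T -> T) (X : {set T}) :
  {in X, forall x, f x \in X} -> {in X, forall x, f (f x) = x} ->
  {in X, forall x, f x != x} -> ~~ odd #|X|.
Proof.
have [n] := ubnP #|X|; elim: n X => // n IH X Xn fX fK fN.
have [->|[x xX]] := set_0Vmem X; first by rewrite cards0.
have card : #|X| = #|X :\ x :\ f x|.+2.
  by rewrite (cardsD1 x) xX (cardsD1 (f x) (X :\ x)) !inE fN // fX.
rewrite card /= negbK; apply: IH; first by lia.
- move=> y; rewrite !inE => /and3P[yfx yx yX]; rewrite fX // andbT; apply/andP; split.
    by apply: contraNneq yx => /(congr1 f); rewrite !fK // => ->.
  by apply: contraNneq yfx => <-; rewrite fK.
- by move=> y; rewrite !inE => /and3P[_ _ /fK].
- by move=> y; rewrite !inE => /and3P[_ _ /fN].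
Qed.

End Components.

(** * Switching one smoothing *)

Definition update (C : finType) (s : {ffun C -> bool}) (c : C) (b : bool) : {ffun C -> bool} :=
  [ffun c' => if c' == c then b else s c'].

Section Reconnection.
Variables (T : finType) (l : seq (T * T)) (x0 x1 x2 x3 : T).
Local Notation R := (connect (pairs l)).
Local Notation np := (n_comp (pairs ((x0, x1) :: (x2, x3) :: l)) predT).
Local Notation nm := (n_comp (pairs ((x0, x3) :: (x2, x1) :: l)) predT).

Let countp := n_comp_cons ((x2, x3) :: l) x0 x1.
Let countp' := n_comp_cons l x2 x3.
Let countm := n_comp_cons ((x2, x1) :: l) x0 x3.
Let countm' := n_comp_cons l x2 x1.
Let sym := pairs_sym l.

(** The [x]s stand for the ends at a crossing and [l] for the rest of the state. Each added pair
    loses at most one class; if neither positive pair loses any, then [x0 ~ x1] and [x2 ~ x3], and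
    at most one negative pair does. *)
Lemma reconnect_le : np <= nm.+1.
Proof.
have [r23|/negPf n23] := boolP (R x2 x3); last first.
  move: countp countp' countm countm'; rewrite n23.
  by do 3!case: (connect _ _ _) => /=; lia.
have [r01|n01] := boolP (R x0 x1); last first.
  have np01 : connect (pairs ((x2, x3) :: l)) x0 x1 = false.
    rewrite connect_cons (negPf n01) -!(same_connect_r sym r23) !orbb.
    by apply: contraNF n01 => /andP[r02]; rewrite [R x1 _]sym; exact: connect_trans.
  move: countp countp' countm countm'; rewrite np01.
  by do 3!case: (connect _ _ _) => /=; lia.
move: countp countp' countm countm'; rewrite !connect_cons.
by rewrite [R x3 x2]sym r23 r01 !orbT /=; case: (R x2 x1) => /=; lia.
Qed.

Lemma reconnect_split : R x0 x1 -> R x2 x3 -> ~~ R x2 x1 -> np = nm.+1.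
Proof.
move=> r01 r23 /negPf n21; move: countp countp' countm countm'.
by rewrite !connect_cons [R x3 x2]sym r23 r01 n21 !orbT /=; lia.
Qed.

(** The negative pairs close arcs that [l] already joins, so they lose no class, while the positive
    pairs merge two distinct classes. *)
Lemma reconnect_merge : R x0 x3 -> R x2 x1 -> ~~ R x0 x1 -> np < nm.
Proof.
move=> r03 r21 n01; move: countp countp' countm countm'.
rewrite !connect_cons r03 r21 (negPf n01) /=.
have -> : R x2 x3 = false.
  by apply: contraNF n01 => r23; rewrite (connect_trans r03) // (connect_trans _ r21) // sym.
have -> : R x0 x2 = false.
  by apply: contraNF n01 => r02; apply: connect_trans r02 r21.
by rewrite [R x1 x2]sym r21 /=; lia.
Qed.

End Reconnection.

Section Flip.
Variable D : diagram.
Notation darts D := (dart (crossing D) (marker D)).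
Implicit Types (s : state D) (c : crossing D) (x y : darts D).

(** The curves of [s] with the crossing [c] deleted, its four darts being left as loose ends. *)
Definition cut_step s c : rel (darts D) :=
  [rel x y | (y == edge x) ||
     match x with
     | inl (c', i) => (c' != c) && (y == xdart c' (smoothing (s c') i))
     | inr (m, b) => y == mdart m (~~ b)
     end].

Lemma cut_step_sym s c : connect_sym (cut_step s c).
Proof.
apply: sym_connect_sym => x y; rewrite /cut_step /=; congr (_ || _).
  by apply/eqP/eqP => ->; rewrite edgeK.
case: x y => [[d i]|[m b]] [[d' i']|[m' b']]; rewrite ?andbF //.
- by apply/andP/andP => -[? /eqP[-> ->]]; rewrite smoothingK.
- by apply/eqP/eqP => -[-> ->]; rewrite negbK.
Qed.

Lemma cut_step_update s c b : cut_step (update s c b) c =2 cut_step s c.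
Proof.
move=> [[d i]|//] y; rewrite /cut_step /= ffunE; case: (d == c) => //.
Qed.

Lemma ordinal4_ind (P : 'I_4 -> Prop) :
  P 0%R -> P 1%R -> P 2%R -> P 3%R -> forall i, P i.
Proof.
by move=> P0 P1 P2 P3 [[|[|[|[|i]]]] hi] //;
  [move: P0|move: P1|move: P2|move: P3]; congr P; apply: val_inj.
Qed.

Lemma smoothing_even b (i : 'I_4) :
  (i = 0 \/ smoothing b i = 0)%R \/ (i = 2 \/ smoothing b i = 2)%R.
Proof.
by case: b; elim/ordinal4_ind: i; by [left; left; apply: val_inj | left; right; apply: val_inj
  | right; left; apply: val_inj | right; right; apply: val_inj].
Qed.

Definition smoothing_arc c b (i : 'I_4) : darts D * darts D :=
  (xdart c i, xdart c (smoothing b i)).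

Lemma connect_state_step s c :
  connect (state_step s) =2
  connect (pairs (smoothing_arc c (s c) 0%R :: smoothing_arc c (s c) 2%R
                    :: rel_pairs (cut_step s c))).
Proof.
apply: eq_connect_subrel => [x y xy|x y].
  have [cxy|] := boolP (cut_step s c x y).
    by apply: pairs_connect; rewrite !inE mem_rel_pairs cxy !orbT.
  rewrite /cut_step /=; case/orP: xy => [->//|].
  case: x => [[d i]|[m b]] /eqP->; rewrite eqxx ?orbT ?andbT // => /norP[_].
  rewrite negbK => /eqP->; apply: connect1; rewrite /pairs /= !inE /smoothing_arc.
  by case: (smoothing_even (s c) i) => -[-> | /(canRL (@smoothingK _)) ->];
    rewrite ?smoothingK !eqxx ?orbT.
rewrite /pairs /= !inE !mem_rel_pairs.
have sub u v : cut_step s c u v -> connect (state_step s) u v.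
  move=> uv; apply: connect1; move: uv; rewrite /cut_step /state_step /=.
  by case: u => [[d i]|//] /orP[->//|/andP[_ ->]]; rewrite orbT.
have arc i : connect (state_step s) (xdart c i) (xdart c (smoothing (s c) i)).
  by apply: connect1; rewrite /state_step /= eqxx orbT.
have sym := state_step_connect_sym s.
by case/orP => /or3P[/eqP[-> ->]|/eqP[-> ->]|/sub]; rewrite // sym.
Qed.

(** A strand that enters at one loose end has to stop at another one; the proof counts darts modulo
    2. *)
Lemma cut_step_ends s c (i : 'I_4) :
  exists2 j, j != i & connect (cut_step s c) (xdart c i) (xdart c j).
Proof.
set x0 := xdart c i; have sym := cut_step_sym s c.
have [/existsP[j /andP[]]|] := boolP [exists j, (j != i) && connect (cut_step s c) x0 (xdart c j)].
  by exists j.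
move/existsPn => no_end.
(* [X] is even because [edge] pairs its darts; without another end of [c] in it, [partner] would
   pair the darts of [X] other than [x0], making [X] odd. *)
pose X := [set x | connect (cut_step s c) x0 x].
have edgeX : ~~ odd #|X|.
  apply: (@even_involution _ (@edge D)) => x; rewrite !inE ?edgeK ?edge_neq // => cx.
  by apply: connect_trans cx (connect1 _); rewrite /cut_step /= eqxx.
pose partner (x : darts D) := match x with
  | inl (d, i) => xdart d (smoothing (s d) i) | inr (m, b) => mdart m (~~ b) end.
suff : ~~ odd #|X :\ x0|.
  by move: edgeX; rewrite (cardsD1 x0 X) inE connect0 /= => /negPn ->.
have noX d j : xdart d j \in X :\ x0 -> d != c.
  rewrite !inE => /andP[jx0 cj]; apply: contraNneq jx0 => dc; move: cj; rewrite dc => cj.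
  by move: (no_end j); rewrite cj andbT negbK => /eqP->.
apply: (@even_involution _ partner) => [x xX|x _|x _].
- have [px0 cx] : partner x != x0 /\ cut_step s c x (partner x).
    case: x xX => [[d j]|[m b]] xX; rewrite /cut_step /partner /=.
      rewrite (noX _ _ xX) eqxx orbT; split => //.
      by apply/eqP => -[dc _]; move: (noX _ _ xX); rewrite dc eqxx.
    by rewrite eqxx orbT.
  by move: xX; rewrite !inE px0 => /andP[_ cx0]; apply: connect_trans cx0 (connect1 _).
- by case: x => [[d j]|[m b]]; rewrite /partner /= ?smoothingK ?negbK.
- case: x => [[d j]|[m b]]; apply/eqP; rewrite /partner => -[] /eqP.
    by rewrite (negPf (smoothing_neq _ _)).
  by case: b.
Qed.

Section Count.
Variables (s : state D) (c : crossing D).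
Local Notation R := (pairs (rel_pairs (cut_step s c))).
Local Notation x_ i := (xdart c i%R : darts D).

Lemma smoothingE : ((smoothing true 0%R = 1%R) * (smoothing true 2%R = 3%R) *
  (smoothing false 0%R = 3%R) * (smoothing false 2%R = 1%R))%type.
Proof. by do !split; apply: val_inj. Qed.

Lemma loopsE b : loops (update s c b) =
  n_comp (pairs (smoothing_arc c b 0%R :: smoothing_arc c b 2%R :: rel_pairs (cut_step s c))) predT.
Proof.
have sb : update s c b c = b by rewrite ffunE eqxx.
rewrite /loops (eq_n_comp (connect_state_step (update s c b) c)) sb.
by rewrite /rel_pairs (eq_filter (fun p => cut_step_update s c b p.1 p.2)).
Qed.

Let RE := connect_rel_pairs (cut_step_sym s c).

Lemma loops_update_le : loops (update s c true) <= (loops (update s c false)).+1.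
Proof. by rewrite !loopsE /smoothing_arc !smoothingE reconnect_le. Qed.

(** By [cut_step_ends] the loose ends can only be joined as [0]--[1] and [2]--[3]. The positive
    smoothing closes these two strands separately and the negative one chains them into one
    curve. *)
Lemma loops_update_split :
  (forall i j : 'I_4, (i < 2)%N -> (2 <= j)%N -> ~~ connect (cut_step s c) (xdart c i) (xdart c j)) ->
  loops (update s c true) = (loops (update s c false)).+1.
Proof.
move=> sep; rewrite !loopsE /smoothing_arc !smoothingE; apply: reconnect_split; rewrite RE.
- have [j] := cut_step_ends s c 0%R.
  by elim/ordinal4_ind: j => //; rewrite (negPf (sep _ _ _ _)).
- have [j] := cut_step_ends s c 2%R.
  by elim/ordinal4_ind: j => //; rewrite cut_step_sym (negPf (sep _ _ _ _)).
- by rewrite cut_step_sym; apply/sep.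
Qed.

(** Darts [1] and [3] represent the two arcs of the negative smoothing. When these lie on different
    curves, the loose ends are joined outside [c] as [0]--[3] and [1]--[2]. *)
Lemma loops_update_merge : ~~ connect (state_step (update s c false)) (x_ 1) (x_ 3) ->
  loops (update s c true) < loops (update s c false).
Proof.
set e := state_step _ => n13; have sym := state_step_connect_sym (update s c false).
have sub x y : connect (cut_step s c) x y -> connect e x y.
  rewrite /e (connect_state_step _ c) -RE => xy; apply: pairs_subset x y xy => p.
  by rewrite !inE !mem_filter cut_step_update => ->; rewrite !orbT.
have arc i : connect e (xdart c i) (xdart c (smoothing false i)).
  by apply: connect1; rewrite /e /state_step /= ffunE !eqxx orbT.
have e03 : connect e (x_ 0) (x_ 3) by have := arc 0%R; rewrite smoothingE.
have e21 : connect e (x_ 2) (x_ 1) by have := arc 2%R; rewrite smoothingE.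
have n01 : ~~ connect e (x_ 0) (x_ 1).
  by apply: contra n13 => e01; rewrite -/e sym (connect_trans _ e01) // sym.
have n02 : ~~ connect e (x_ 0) (x_ 2).
  by apply: contra n01 => e02; apply: connect_trans e02 e21.
have n31 : ~~ connect e (x_ 3) (x_ 1) by rewrite sym.
rewrite !loopsE /smoothing_arc !smoothingE; apply: reconnect_merge; rewrite RE.
- have [j] := cut_step_ends s c 0%R.
  by elim/ordinal4_ind: j => // _ /sub; [rewrite (negPf n01)|rewrite (negPf n02)].
- have [j] := cut_step_ends s c 2%R.
  elim/ordinal4_ind: j => // _ /sub; first by rewrite sym (negPf n02).
  move=> e23; have := connect_trans e03 _; move/(_ (x_ 2)); rewrite sym e23 (negPf n02).
  by move/(_ isT).
- by apply: contra n01 => /sub.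
Qed.

End Count.
End Flip.

(** * Euler's inequality for combinatorial maps *)

Section Euler.
Variable T : finType.
Implicit Types (a b : {perm T}) (x y : T).

Lemma step_connect_sym (e : rel T) :
  (forall x y, e x y -> connect e y x) -> connect_sym e.
Proof.
move=> es; suff sub x y : connect e x y -> connect e y x by move=> x y; apply/idP/idP; exact: sub.
case/connectP => p; elim: p x => [|z p IH] x /=; first by move=> _ ->.
by case/andP => /es zx /IH{}IH /IH; move/connect_trans; apply.
Qed.

Lemma n_comp_class (e : rel T) : connect_sym e ->
  n_comp e predT = #|[set [set y | connect e x y] | x : T]|.
Proof.
move=> es; have -> : n_comp e predT = #|roots e| by apply: eq_card => x; rewrite !inE andbT.
pose cls x := [set y | connect e x y].
have clsE x y : (cls x == cls y) = connect e x y.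
  apply/eqP/idP => [/setP/(_ y)|xy]; first by rewrite !inE connect0.
  by apply/setP => z; rewrite !inE (same_connect es xy).
rewrite -(card_in_imset (f := cls) (D := roots e)) => [|x y rx ry /eqP].
  apply: eq_card => X; apply/imsetP/imsetP => -[x _ ->]; first by exists x.
  exists (fingraph.root e x); first exact: roots_root.
  by apply/eqP; rewrite clsE connect_root.
by rewrite clsE -(root_connect es) (eqP rx) (eqP ry) => /eqP.
Qed.

Lemma mem_porbit_connect a x y : (y \in porbit a x) = fconnect a x y.
Proof.
apply/porbitP/idP => [[i ->]|axy]; first by rewrite permX fconnect_iter.
by exists (findex a x y); rewrite permX iter_findex.
Qed.

Lemma card_porbits a : #|porbits a| = fcard a predT.
Proof.
rewrite n_comp_class; last by apply: fconnect_sym; exact: perm_inj.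
apply: eq_card => X; rewrite /porbits; apply/imsetP/imsetP => -[x _ ->]; exists x => //;
  by apply/setP => y; rewrite mem_porbit_connect inE.
Qed.

Definition map_pairs (a b : T -> T) := rel_pairs [rel x y | (y == a x) || (y == b x)].

(* V - E + F <= 2 K, where b swaps the ends of each edge, so that E is half the
   number of points moved by b; proved by adding the edges one at a time. *)
Lemma euler_inequality a b : involutive b ->
  (2 * (#|porbits (b * a)| + #|porbits a|)
     <= #|[pred x | b x != x]| + 4 * n_comp (pairs (map_pairs a b)) predT)%N.
Proof.
have [n] := ubnP #|[pred x | b x != x]|; elim: n b => // n IH b bn bK.
have [/existsP[x bx]|/existsPn b1] := boolP [exists x, b x != x]; last first.
  have -> : b = 1%g by apply/permP => x; rewrite perm1; apply/eqP; have := b1 x; rewrite negbK.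
  rewrite mul1g card_porbits; suff -> : fcard a predT = n_comp (pairs (map_pairs a (1%g : {perm T}))) predT by lia.
  apply: eq_n_comp => u v; apply/idP/idP; apply: connect_sub => {}u {}v.
    by move=> /eqP<-; apply: pairs_connect; rewrite mem_rel_pairs /= eqxx.
  rewrite /pairs /= !mem_rel_pairs /= !perm1; have sa := fconnect_sym (@perm_inj _ a).
  by case/orP => /orP[] /eqP->; rewrite ?connect0 ?fconnect1 // sa fconnect1.
(* [b'] is [b] with the edge between [x] and [b x] deleted: both ends become fixed points. *)
pose t := tperm x (b x); pose b' := (t * b)%g.
have bE : b = (t * b')%g by rewrite /b' mulgA tperm2 mul1g.
have b'x : b' x = x by rewrite permM tpermL bK.
have b'bx : b' (b x) = b x by rewrite permM tpermR.
have b'z z : z != x -> z != b x -> b' z = b z.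
  by move=> zx zbx; rewrite permM tpermD // eq_sym.
have b'K : involutive b'.
  move=> z; have [->|zx] := eqVneq z x; first by rewrite !b'x.
  have [->|zbx] := eqVneq z (b x); first by rewrite !b'bx.
  rewrite (b'z _ zx zbx) b'z ?bK //.
    by apply: contraNneq zbx => <-; rewrite bK.
  by apply: contraNneq zx => /perm_inj ->.
have supp : #|[pred z | b z != z]| = #|[pred z | b' z != z]|.+2.
  rewrite (cardD1 x) inE bx (cardD1 (b x)) !inE bx bK eq_sym bx !add1n; do 2!congr _.+1.
  apply: eq_card => z; rewrite !inE.
  have [->|zbx] := eqVneq z (b x); first by rewrite b'bx eqxx.
  have [->|zx] := eqVneq z x; first by rewrite b'x eqxx.
  by rewrite b'z.
have /(IH b')/(_ b'K) : (#|[pred z | b' z != z]| < n)%N by move: bn; rewrite supp; lia.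
have := porbits_mul_tperm (b' * a) x (b x); rewrite /= mulgA -bE eq_sym bx.
have comps : (n_comp (pairs (map_pairs a b)) predT
    + ~~ connect (pairs (map_pairs a b')) x (b x) = n_comp (pairs (map_pairs a b')) predT)%N.
  rewrite -(n_comp_cons (map_pairs a b') x (b x)); congr (_ + _)%N; apply: eq_n_comp.
  have sym := pairs_sym.
  apply: eq_connect_subrel => u v.
    have dir w z : (z == a w) || (z == b w) -> connect (pairs ((x, b x) :: map_pairs a b')) w z.
      case/orP => [wz|/eqP->].
        by apply: pairs_connect; rewrite inE mem_rel_pairs /= wz orbT.
      have [->|wx] := eqVneq w x; first by apply: pairs_connect; exact: mem_head.
      have [->|wbx] := eqVneq w (b x); first by rewrite bK sym; apply: pairs_connect; exact: mem_head.
      by apply: pairs_connect; rewrite inE mem_rel_pairs /= b'z // eqxx !orbT.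
    by rewrite {1}/pairs /= !mem_rel_pairs => /orP[/dir //|/dir]; rewrite sym.
  have dir w z : (z == a w) || (z == b' w) -> connect (pairs (map_pairs a b)) w z.
    case/orP => [wz|/eqP->].
      by apply: pairs_connect; rewrite mem_rel_pairs /= wz.
    have [->|wx] := eqVneq w x; first by rewrite b'x connect0.
    have [->|wbx] := eqVneq w (b x); first by rewrite b'bx connect0.
    by apply: pairs_connect; rewrite mem_rel_pairs /= b'z // eqxx !orbT.
  have xbx : connect (pairs (map_pairs a b)) x (b x).
    by apply: pairs_connect; rewrite mem_rel_pairs /= eqxx orbT.
  rewrite {1}/pairs /= !inE !mem_rel_pairs.
  by case/orP => /orP[/eqP[-> ->]|/dir] //; rewrite sym.
move: comps.
(* Restoring an edge between two different faces merges them and loses at most one component. *)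
have [xbx|_] := boolP (x \in porbit (b' * a) (b x)); last first.
  rewrite supp; case: (connect _ _ _) => /=;
    by move: #|porbits (b * a)| #|porbits (b' * a)| #|porbits a| #|_|; lia.
(* Restoring an edge inside one face splits that face; its boundary walk already connects the two
   ends, so no component is lost. *)
suff -> : connect (pairs (map_pairs a b')) x (b x).
  by rewrite supp /=; move: #|porbits (b * a)| #|porbits (b' * a)| #|porbits a| #|_| => p q r u; lia.
move: xbx; rewrite mem_porbit_connect pairs_sym; apply: connect_sub => u v /eqP<-.
rewrite permM; apply: (@connect_trans _ _ (b' u)); apply: pairs_connect;
  by rewrite mem_rel_pairs /= eqxx ?orbT.
Qed.

End Euler.

(** * Cutting a planar map along a face *)

Lemma leq_n_comp (T : finType) (e e' : rel T) : connect_sym e -> connect_sym e' ->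
  (forall x y, e x y -> connect e' x y) -> (n_comp e' predT <= n_comp e predT)%N.
Proof.
move=> es es' ee'.
have -> : n_comp e' predT = #|roots e'| by apply: eq_card => x; rewrite !inE andbT.
apply: leq_trans (leq_codom_n_comp (h := fingraph.root e') es _).
  apply: subset_leq_card; apply/subsetP => x; rewrite inE /roots => /eqP<-; exact: codom_f.
by move=> x y /ee'; rewrite -(root_connect es') => /eqP.
Qed.

Section Planar.
Variable D : diagram.
Notation darts D := (dart (crossing D) (marker D)).
Implicit Types (c : crossing D) (x y : darts D).

Lemma clockwise_inj : injective (@clockwise D).
Proof.
apply: (can_inj (g := fun x => match x with
  | inl (c, i) => xdart c (i + 1)%R | inr (m, b) => mdart m (~~ b) end)).
by move=> [[c i]|[m b]] /=; rewrite ?subrK ?negbK.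
Qed.

Definition clockwise_perm : {perm darts D} := perm clockwise_inj.
Definition edge_perm : {perm darts D} := perm (inv_inj (@edgeK D)).

Lemma clockwise_permE x : clockwise_perm x = clockwise x.
Proof. by rewrite permE. Qed.

Lemma edge_permE x : edge_perm x = edge x.
Proof. by rewrite permE. Qed.

Lemma face_inj : injective (@face D).
Proof. by move=> x y /clockwise_inj /(inv_inj (@edgeK D)). Qed.

Lemma face_perm x : (edge_perm * clockwise_perm)%g x = face x.
Proof. by rewrite permM !permE. Qed.

Definition graph_pairs := map_pairs (@clockwise D) (@edge D).

Lemma region_step_sym : connect_sym (@region_step D).
Proof.
apply: step_connect_sym => x y /or3P[/eqP->|xy|xy]; last 2 first.
- by apply: connect1; rewrite /region_step /= xy !orbT.
- by apply: connect1; rewrite /region_step /= xy !orbT.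
have : fconnect (@face D) (face x) x by rewrite (fconnect_sym face_inj) fconnect1.
by apply: connect_sub => u v /eqP<-; apply: connect1; rewrite /region_step /= eqxx.
Qed.

(* The boundary walks join the regions to the components of the graph into a
   connected bipartite graph, which has at least #regions + #components - 1
   edges; with the hypothesis on the Euler characteristic of the sphere, this
   bounds below the number of boundary walks. *)
Lemma planar_faces : planar D -> (0 < #|darts D|)%N ->
  (2 * n_comp (pairs graph_pairs) predT + #|crossing D| <= fcard (@face D) predT)%N.
Proof.
rewrite /planar => /orP[/eqP-> //|/andP[conn /eqP euler]] D_gt0.
have fsym := fconnect_sym face_inj.
pose lF := rel_pairs (frel (@face D)); pose lR := rel_pairs (@region_step D).
have cF : connect (pairs lF) =2 fconnect (@face D) by apply: connect_rel_pairs.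
have cR : connect (pairs lR) =2 connect (@region_step D) by apply: connect_rel_pairs; exact: region_step_sym.
have FK : subrel (connect (pairs lF)) (connect (pairs graph_pairs)).
  apply: connect_pairs (@pairs_sym _ _) _ => u v; rewrite mem_rel_pairs => /eqP<-.
  apply: (@connect_trans _ _ (edge u)); apply: pairs_connect;
    by rewrite mem_rel_pairs /= eqxx ?orbT.
(* For [K] graph components, [R] regions and [F] boundary walks this becomes [K + R <= F + 1], to be
   combined with [2 R = #|crossing D| + F + 2]. *)
have := n_comp_submodular lR FK.
have -> : n_comp (pairs lF) predT = fcard (@face D) predT by apply: eq_n_comp.
have -> : n_comp (pairs (lR ++ lF)) predT = n_comp (@region_step D) predT.
  apply: eq_n_comp => u v; apply/idP/idP.
    apply: connect_pairs region_step_sym _ u v => u v.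
    rewrite mem_cat !mem_rel_pairs => /orP[uv|uv]; apply: connect1 => //.
    by rewrite /region_step /= eq_sym (eqP uv) eqxx.
  apply: connect_sub => {}u {}v uv; apply: pairs_connect.
  by rewrite mem_cat mem_rel_pairs uv.
have [x0 _] := card_gt0P D_gt0.
have -> : n_comp (pairs (lR ++ graph_pairs)) predT = 1%N.
  rewrite -(n_comp_connect (pairs_sym (lR ++ graph_pairs)) x0); apply: eq_n_comp_r => y.
  rewrite !inE; apply/esym; move/forallP/(_ x0)/forallP/(_ y): conn; apply: connect_sub => u v /=.
  case/or3P => uv; apply: pairs_connect; rewrite mem_cat !mem_rel_pairs /= ?uv ?orbT //.
lia.
Qed.

Section Cut.
Variable c : crossing D.
Local Notation x_ i := (xdart c i%R : darts D).

(** Multiplication by this transposition breaks the cycle of darts at [c] into two vertices,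
    [{0, 1}] and [{2, 3}]. *)
Let cut := tperm (x_ 1) (x_ 3).
Let split_perm := (clockwise_perm * cut)%g.

Let split_perm_off d i : d != c -> split_perm (xdart d i) = clockwise (xdart d i).
Proof.
by move=> dc; rewrite permM clockwise_permE tpermD //; apply/eqP => -[cd]; rewrite cd eqxx in dc.
Qed.

Let split_permE : ((split_perm (x_ 0) = x_ 1) * (split_perm (x_ 1) = x_ 0) *
  (split_perm (x_ 2) = x_ 3) * (split_perm (x_ 3) = x_ 2))%type.
Proof.
have cw i j : (i - 1)%R = j -> clockwise_perm (xdart c i) = xdart c j by move=> <-; rewrite permE.
have neq i j : (i != j)%N -> xdart c i != xdart c j by apply: contraNneq => -[->].
split; [split; [split|]|]; rewrite permM.
- by rewrite (cw _ 3%R) ?tpermR //; apply: val_inj.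
- by rewrite (cw _ 0%R) ?tpermD ?neq //; apply: val_inj.
- by rewrite (cw _ 1%R) ?tpermL //; apply: val_inj.
- by rewrite (cw _ 2%R) ?tpermD ?neq //; apply: val_inj.
Qed.

(** The split map has the same edges, one more vertex and one more face, so [planar_faces] and
    [euler_inequality] force an extra component. Strands that avoid [c] stay in a component of the
    split map, whatever the state. *)
Lemma face_separates (s : state D) :
  planar D -> fconnect (@face D) (x_ 1) (x_ 3) ->
  forall i j : 'I_4, (i < 2)%N -> (2 <= j)%N ->
    ~~ connect (cut_step s c) (xdart c i) (xdart c j).
Proof.
move=> plD f13; pose K' := pairs (map_pairs split_perm edge_perm).
have sym : connect_sym K' := pairs_sym _.
have K'split x : connect K' x (split_perm x).
  by apply: pairs_connect; rewrite mem_rel_pairs /= eqxx.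
have K'edge x : connect K' x (edge x).
  by apply: pairs_connect; rewrite mem_rel_pairs /= edge_permE eqxx orbT.
have K'10 : connect K' (x_ 1) (x_ 0) by have := K'split (x_ 1); rewrite split_permE.
have K'23 : connect K' (x_ 2) (x_ 3) by have := K'split (x_ 2); rewrite split_permE.
have K'm m b : connect K' (mdart m b) (mdart m (~~ b)).
  have <- : split_perm (mdart m b) = mdart m (~~ b) by rewrite permM clockwise_permE tpermD.
  exact: K'split.
have n12 : ~~ connect K' (x_ 1) (x_ 2).
  apply/negP => K'12.
  (* If the two halves of [c] were still connected, every adjacency of the original graph would
     survive the splitting, and no component would be gained. *)
  have KK' : (n_comp K' predT <= n_comp (pairs graph_pairs) predT)%N.
    apply: leq_n_comp => //; first exact: pairs_sym.
    have K'c i : connect K' (x_ 1) (xdart c i).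
      by elim/ordinal4_ind: i => //; apply: connect_trans K'12 K'23.
    have dir u v : (v == clockwise u) || (v == edge u) -> connect K' u v.
      case/orP => /eqP-> //; case: u => [[d i]|[m b]] /=; last exact: K'm.
      have [->|dc] := eqVneq d c; first by have := K'c (i - 1)%R; apply: connect_trans; rewrite sym; exact: K'c.
      by have := K'split (xdart d i); rewrite split_perm_off.
    move=> u v; rewrite /pairs /= !mem_rel_pairs => /orP[/dir //|/dir]; by rewrite sym.
  have epK : involutive edge_perm by move=> x; rewrite !edge_permE edgeK.
  have D_gt0 : (0 < #|darts D|)%N by apply/card_gt0P; exists (x_ 0).
  have := euler_inequality split_perm epK.
  have -> : #|[pred x | edge_perm x != x]| = (#|crossing D| * 4 + #|marker D| * 2)%N.
    transitivity #|darts D|; first by apply: eq_card => x; rewrite !inE edge_permE edge_neq.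
    by rewrite card_sum !card_prod card_ord card_bool.
  have := planar_faces plD D_gt0.
  (* [h] labels the vertices of the split map; [inr tt] is the half [{2, 3}] of [c]. *)
  pose h (x : darts D) : crossing D + marker D + unit := match x with
    | inl (d, i) => if (d == c) && (2 <= i)%N then inr tt else inl (inl d)
    | inr (m, _) => inl (inr m) end.
  have : (#|crossing D| + #|marker D| + 1 <= #|porbits split_perm|)%N.
    rewrite -card_unit -!card_sum card_porbits.
    apply: leq_trans (leq_codom_n_comp (h := h) (fconnect_sym (@perm_inj _ _)) _).
      apply: subset_leq_card; apply/subsetP => -[[d|m]|[]] _; apply/codomP.
      - by exists (xdart d 0%R); rewrite /= andbF.
      - by exists (mdart m true).
      - by exists (x_ 2); rewrite /= eqxx.
    move=> u v /eqP<-; case: u => [[d i]|[m b]]; last by rewrite permM clockwise_permE tpermD.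
    have [->|dc] := eqVneq d c; last by rewrite split_perm_off //= (negPf dc).
    by elim/ordinal4_ind: i; rewrite split_permE /= eqxx.
  have : #|porbits (edge_perm * split_perm)| = (fcard (@face D) predT).+1.
    (* Inversion moves the transposition to the left, as [porbits_mul_tperm] wants it; by [f13] it
       cuts one face in two. *)
    rewrite mulgA -porbitsV invMg tpermV.
    have := porbits_mul_tperm (edge_perm * clockwise_perm)^-1 (x_ 1) (x_ 3).
    rewrite /= porbitV porbitsV mem_porbit_connect.
    have fE : (edge_perm * clockwise_perm)%g =1 @face D by exact: face_perm.
    rewrite (card_porbits (edge_perm * clockwise_perm)) (eq_fcard fE) (eq_fconnect fE) (fconnect_sym face_inj) f13 /=.
    have -> : x_ 1 != x_ 3 by apply/eqP => -[].
    by rewrite addn0 addn1.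
  move: KK'; rewrite -/K'.
  move: (n_comp K' _) (n_comp (pairs graph_pairs) _) #|porbits _| #|porbits _| (fcard _ _).
  by move: #|crossing D| #|marker D| => *; lia.
move=> i j i2 j2; apply: contra n12 => cij.
have : connect K' (xdart c i) (xdart c j).
  move: cij; apply: connect_sub => u v /orP[/eqP-> //|].
  case: u => [[d p]|[m b]]; last by move/eqP->; exact: K'm.
  case/andP => dc /eqP->; rewrite /smoothing; case: ifP => _.
    by have := K'split (xdart d p); rewrite split_perm_off.
  rewrite sym; have := K'split (xdart d (p + 1)%R); rewrite split_perm_off //= addrK //.
have to1 : connect K' (x_ 1) (xdart c i).
  by elim/ordinal4_ind: i i2 {cij} => // _; exact: connect0.
have to2 : connect K' (xdart c j) (x_ 2).
  by elim/ordinal4_ind: j j2 {cij} => // _; rewrite ?connect0 // sym.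
by move=> K'ij; apply: connect_trans to1 (connect_trans K'ij to2).
Qed.

End Cut.
End Planar.

(** * Alternating diagrams *)

Section Alternating.
Variable D : diagram.
Notation darts D := (dart (crossing D) (marker D)).
Implicit Types (c : crossing D) (x y o : darts D).

Definition at_marker x := if x is inr _ then true else false.

Definition markers_until o n :=
  forall j, (j < n)%N -> at_marker (edge (iter j (@face D) o)).

(* Otherwise the walk would be its own reversal, hence fixed or flipped midway. *)
Lemma markers_until_neq o n j : markers_until o n -> (j <= n)%N ->
  edge (iter n (@face D) o) != iter j (@face D) o.
Proof.
have [d] := ubnP (n - j); elim: d n j => // d IH n j nj mn jn.
have [->|jn'] := eqVneq j n; first exact: edge_neq.
case: n nj mn jn jn' => [|n] nj mn jn jn'; first by lia.
apply/eqP => en; have := mn n (ltnSn n); case en' : (edge _) => [//|[m b]] _.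
have xn : iter n.+1 (@face D) o = mdart m (~~ b) by rewrite /= /face en'.
have xnj : iter n.+1 (@face D) o = edge (iter j (@face D) o) by rewrite -en edgeK.
have [jn''|jn''] := eqVneq j n.
  by move: xn; rewrite xnj jn'' en' => -[]; case: b {en'}.
have mn' : markers_until o n by move=> i ilt; apply: mn; lia.
have /negP[] := IH n j.+1 ltac:(lia) mn' ltac:(lia).
by rewrite en' /= /face -xnj xn /= negbK.
Qed.

(** At a marker, turning clockwise is going straight on, so the walk follows a single strand. *)
Lemma markers_until_arc o n : markers_until o n ->
  same_arc o (edge (iter n (@face D) o)).
Proof.
elim: n => [|n IH] mn; first by apply: connect1; rewrite /arc_step /= eqxx.
have mn' : markers_until o n by move=> i ilt; apply: mn; lia.
apply: connect_trans (IH mn') _.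
apply: (@connect_trans _ _ (iter n.+1 (@face D) o)); apply: connect1; last first.
  by rewrite /arc_step /= eqxx.
rewrite /= /face; have := mn n (ltnSn n); case: (edge _) => [//|[m b]] _.
by rewrite /arc_step /= eqxx orbT.
Qed.

(* Markers carry no parity: [n] counts those passed since the last crossing, which
   the walk left by an odd dart. *)
Definition odd_walk x := exists c (i : 'I_4) n,
  [/\ odd i, x = iter n (@face D) (xdart c i) & markers_until (xdart c i) n].

Lemma odd_walk_crossing c (i : 'I_4) : odd_walk (xdart c i) -> odd i.
Proof.
case=> d [j [[|n] [odd_j xE mn]]]; first by case: xE => _ ->.
by move: xE (mn n (ltnSn n)); rewrite iterS {1}/face; case: (edge _) => [[? ?]|[? ?]].
Qed.

Hypothesis alt : alternating D.

(** The walk entered this arc by an odd dart, and alternation gives the two ends of an arc opposite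
    parities; [markers_until_neq] ensures that they are distinct darts. *)
Lemma odd_walk_edge c (i : 'I_4) x : odd_walk x -> edge x = xdart c i -> ~~ odd i.
Proof.
move=> [d [j [n [odd_j -> mn]]]] ex.
have := markers_until_arc mn; have := markers_until_neq mn (leq0n n).
by rewrite ex /= eq_sym => neq /(alt neq); rewrite odd_j; case: (odd i).
Qed.

Lemma odd_ordS (i : 'I_4) : (odd (i + 1)%R = ~~ odd i) * (odd (i - 1)%R = ~~ odd i).
Proof. by elim/ordinal4_ind: i. Qed.

(** At a crossing the walk arrives on an even dart and leaves by its clockwise neighbour, which is
    odd again. *)
Lemma odd_walk_face x : odd_walk x -> odd_walk (face x).
Proof.
move=> xJ; case ex : (edge x) => [[c i]|[m b]].
  exists c, (i - 1)%R, 0%N; split => //=; last by rewrite /face ex.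
  by rewrite odd_ordS (odd_walk_edge xJ ex).
case: xJ => d [j [n [odd_j xE mn]]]; exists d, j, n.+1; split => //; first by rewrite xE.
move=> k; rewrite ltnS leq_eqVlt => /orP[/eqP->|]; last exact: mn.
by rewrite -xE ex.
Qed.

(** A negative smoothing sends an even dart to its clockwise neighbour. Since the walk arrives at
    crossings on even darts, it turns exactly as the curve of the all-negative state does. *)
Lemma negative_curve_face (s : state D) c :
  (forall d, s d = false) -> connect (state_step s) (xdart c 1%R) (xdart c 3%R) ->
  fconnect (@face D) (xdart c 1%R) (xdart c 3%R).
Proof.
move=> neg; set o := xdart c 1%R; pose O x := fconnect (@face D) o x.
have Ow x : O x -> odd_walk x.
  move=> /iter_findex<-; elim: (findex _ _ _) => [|n IH]; last exact: odd_walk_face.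
  by exists c, 1%R, 0%N.
have faceO x : O (face x) = O x by rewrite /O -(same_fconnect1_r (@face_inj D)).
pose a := [pred x | O x || O (edge x)].
have acl : closed (state_step s) a.
  apply: (intro_closed (state_step_connect_sym s)) => x y; rewrite /state_step /= !inE.
  case/orP => [/eqP->|]; first by rewrite edgeK orbC.
  have turn u v : clockwise u = v -> O (edge u) = O v.
    by move=> <-; rewrite -faceO /face edgeK.
  case: x => [[d i]|[m b]] /eqP-> /orP[Ox|Oex].
  - have odd_i := odd_walk_crossing (Ow _ Ox); rewrite neg /smoothing odd_i /=.
    by rewrite orbC (turn _ (xdart d i)) ?Ox //= addrK.
  - have even_i := odd_walk_edge (Ow _ Oex) (edgeK _).
    rewrite neg /smoothing (negPf even_i) /=.
    by rewrite -(turn (xdart d i)) ?Oex.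
  - by rewrite orbC (turn _ (mdart m b)) ?Ox //= negbK.
  - by rewrite -(turn (mdart m b)) ?Oex.
move=> c13; have := closed_connect acl c13; rewrite !inE /O connect0 /=.
case: (boolP (fconnect _ _ (xdart c 3%R))) => //= _ /esym O3.
(* Otherwise the walk would arrive at [c] on dart [3], which is odd. *)
by have := odd_walk_edge (Ow _ O3) (edgeK _).
Qed.

(** The cases are whether the two negative arcs at [c] lie on one curve of [s0]; if so,
    [face_separates] gives the conclusion in all states at once. *)
Lemma crossing_dichotomy c (s0 : state D) : planar D -> (forall d, s0 d = false) ->
  (forall s : state D, loops (update s c true) = (loops (update s c false)).+1) \/
  (loops (update s0 c true) < loops s0)%N.
Proof.
move=> plD neg; have s0E : update s0 c false = s0.
  by apply/ffunP => d; rewrite ffunE neg; case: ifP.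
have [c13|n13] := boolP (connect (state_step s0) (xdart c 1%R) (xdart c 3%R)).
  left=> s; apply: loops_update_split; apply: face_separates plD _.
  exact: negative_curve_face neg c13.
by right; rewrite -{2}s0E; apply: loops_update_merge; rewrite s0E.
Qed.

End Alternating.

(** * States of the twist region *)

Section TwistStates.
Variables (T : tangle) (k : nat).
Notation darts D := (dart (crossing D) (marker D)).
Local Notation Lk := (L_ T k).
Implicit Types (s : {ffun tcrossing T -> bool}) (t : {ffun 'I_k -> bool}).

Definition twist_state s t : state Lk :=
  [ffun c => match c with inl c => s c | inr i => t i end].

(** A negative smoothing lets the two horizontal strands of the twist region run straight
    through. *)
Lemma smoothing_false (p : 'I_4) : smoothing false p = rev_ord p.
Proof. by elim/ordinal4_ind: p; apply: val_inj. Qed.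

Lemma smoothing_true_lt2 (p : 'I_4) : (smoothing true p < 2)%N = (p < 2)%N.
Proof. by elim/ordinal4_ind: p. Qed.

Local Notation tw l p := (xdart (inr l) p : darts Lk).
Local Notation port p := (mdart (inr p) true : darts Lk).

Lemma edge_right (l l' : 'I_k) (p : 'I_4) : (p < 2)%N -> l' = l.+1 :> nat ->
  edge (tw l p) = tw l' (rev_ord p).
Proof.
move=> p2 ll'; rewrite /= /gedge /= p2; case: insubP => [j _ /= jl|]; last by rewrite -ll' ltn_ord.
by have -> : j = l' by apply: val_inj; rewrite /= jl.
Qed.

Lemma edge_left (l l' : 'I_k) (p : 'I_4) : (2 <= p)%N -> l = l'.+1 :> nat ->
  edge (tw l p) = tw l' (rev_ord p).
Proof.
move=> p2 ll'; have p2' : (rev_ord p < 2)%N by rewrite rev_ord4_lt2 ltnNge p2.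
by apply: (canLR (@edgeK _)); rewrite (edge_right p2' ll') rev_ordK.
Qed.

Lemma edge_last (l : 'I_k) (p : 'I_4) : (p < 2)%N -> l.+1 = k -> edge (tw l p) = port p.
Proof.
move=> p2 lk; rewrite /= /gedge /= p2; case: insubP => [j /= + jl|//].
by rewrite /= lk ltnn.
Qed.

Lemma edge_first (l : 'I_k) (p : 'I_4) : (2 <= p)%N -> l = 0%N :> nat -> edge (tw l p) = port p.
Proof. by move=> p2 l0; rewrite /= /gedge /= ltnNge p2 /= l0. Qed.

Section Single.
Variables (i : 'I_k) (s : {ffun tcrossing T -> bool}) (t : {ffun 'I_k -> bool}).
Hypothesis t0 : forall l, l != i -> t l = false.

Local Notation e := (state_step (twist_state s t)).

Let sym : connect_sym e := @state_step_connect_sym _ _.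

Let edge_e x : connect e x (edge x).
Proof. by apply: connect1; rewrite /state_step /= eqxx. Qed.

Let tw_e l p : l != i -> connect e (tw l p) (tw l (rev_ord p)).
Proof.
by move=> li; apply: connect1; rewrite /state_step /= ffunE t0 // smoothing_false eqxx orbT.
Qed.

Lemma connect_left (l : 'I_k) (p : 'I_4) : (l <= i)%N -> (2 <= p)%N -> connect e (tw l p) (port p).
Proof.
case: l => l hl /=; elim: l hl => [|l IH] hl li p2.
  by rewrite -(@edge_first (Ordinal hl)).
have hl' : (l < k)%N by exact: ltnW.
apply: connect_trans (edge_e _) _; rewrite (@edge_left _ (Ordinal hl')) //.
apply: connect_trans (tw_e _ _) _; first by rewrite -val_eqE /=; lia.
by rewrite rev_ordK; apply: IH => //; exact: ltnW.
Qed.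

Lemma connect_right (l : 'I_k) (p : 'I_4) : (i <= l)%N -> (p < 2)%N -> connect e (tw l p) (port p).
Proof.
have [n] := ubnP (k - l); elim: n l => // n IH l nl il p2.
have [lk|lk] := eqVneq l.+1 k; first by rewrite -(edge_last p2 lk).
have hl : (l.+1 < k)%N by have := ltn_ord l; lia.
apply: connect_trans (edge_e _) _; rewrite (@edge_right _ (Ordinal hl)) //.
apply: connect_trans (tw_e _ _) _; first by rewrite -val_eqE /=; lia.
by rewrite rev_ordK; apply: IH => //=; lia.
Qed.

(** The end of the tangle reached from dart [p] of [l] without meeting crossing [i]: from a dart
    that faces [i], the strand first crosses [l]. *)
Definition twist_port (l : 'I_k) (p : 'I_4) : 'I_4 :=
  if (l < i)%N == (p < 2)%N then rev_ord p else p.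

Lemma connect_port l p : l != i -> connect e (tw l p) (port (twist_port l p)).
Proof.
move=> li; have li' : (i <= l)%N = ~~ (l < i)%N by rewrite leqNgt.
rewrite /twist_port; case: (boolP (l < i)%N) li' => lti li'; case: (boolP (p < 2)%N) => p2 /=.
- apply: connect_trans (tw_e _ li) _; apply: connect_left (ltnW lti) _.
  by rewrite leqNgt rev_ord4_lt2 negbK.
- by apply: connect_left (ltnW lti) _; rewrite leqNgt.
- by apply: connect_right; rewrite ?li'.
- apply: connect_trans (tw_e _ li) _; apply: connect_right; rewrite ?li' //.
  by rewrite rev_ord4_lt2.
Qed.

Lemma connect_single p : connect e (tw i p) (port p).
Proof.
by case: (boolP (p < 2)%N) => p2; [apply: connect_right | apply: connect_left; rewrite // leqNgt].
Qed.

Local Notation L1 := (L_ T 1).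

Definition of_single (x : darts L1) : darts Lk :=
  match x with
  | inl (inl c, p) => xdart (inl c) p
  | inl (inr _, p) => xdart (inr i) p
  | inr (m, b) => mdart m b
  end.

(** Crossings other than [i] are smoothed negatively, so their darts can be slid along horizontal
    strands to the ends of the tangle. *)
Definition to_single (x : darts Lk) : darts L1 :=
  match x with
  | inl (inl c, p) => xdart (inl c) p
  | inl (inr l, p) => if l == i then xdart (inr ord0) p else mdart (inr (twist_port l p)) true
  | inr (m, b) => mdart m b
  end.

Lemma of_single_outer x : of_single (@outer T (twist 1) x) = @outer T (twist k) x.
Proof. by case: x => [[[c j]|[m b']]|p]. Qed.

Lemma to_single_outer x : to_single (@outer T (twist k) x) = @outer T (twist 1) x.
Proof. by case: x => [[[c j]|[m b']]|p]. Qed.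

Local Notation e1 := (state_step (extend (twist 1) s (t i))).

Let sym1 : connect_sym e1 := @state_step_connect_sym _ _.

Let single_port p : connect e1 (xdart (inr ord0) p) (mdart (inr p) true).
Proof. by apply: connect1; apply/orP; left; rewrite edge_cross. Qed.

Lemma to_single_edge (l : 'I_k) (p : 'I_4) : connect e1 (to_single (tw l p)) (to_single (edge (tw l p))).
Proof.
(* An edge at a left dart either reverses one at a right dart or leaves the region at its left
   end. *)
have right (l' : 'I_k) (q : 'I_4) : (q < 2)%N ->
    connect e1 (to_single (tw l' q)) (to_single (edge (tw l' q))).
  move=> q2; have [lk|lk] := eqVneq l'.+1 k.
    rewrite (edge_last q2 lk) /=; case: eqVneq => [_|li]; first exact: single_port.
    rewrite /twist_port q2; have -> : (l' < i)%N = false by have := ltn_ord i; lia.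
    exact: connect0.
  have hl : (l'.+1 < k)%N by have := ltn_ord l'; lia.
  rewrite (@edge_right _ (Ordinal hl)) //= /twist_port q2 rev_ord4_lt2 q2 rev_ordK /=.
  rewrite -[Ordinal hl == i]val_eqE -[l' == i]val_eqE /=.
  case: (ltngtP l' i) => li /=.
  - case: (eqVneq l'.+1 i) => [_|li']; first by rewrite sym1; exact: single_port.
    by have -> : (l'.+1 < i)%N by lia.
  - have -> : (l'.+1 == i) = false by lia.
    by have -> : (l'.+1 < i)%N = false by lia.
  - have -> : (l'.+1 == i) = false by lia.
    by have -> : (l'.+1 < i)%N = false by lia; exact: single_port.
have [p2|p2] := ltnP p 2; first exact: right.
have [l0|l0] := posnP l.
  rewrite (edge_first p2 l0) /=; case: eqVneq => [_|li]; first exact: single_port.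
  rewrite /twist_port (ltnNge p) p2 /=.
  by have -> : (l < i)%N by move: li; rewrite -val_eqE /=; lia.
have hl : (l.-1 < k)%N by have := ltn_ord l; lia.
have ll : l = (Ordinal hl).+1 :> nat by rewrite /= prednK.
rewrite (edge_left p2 ll) sym1; have := right (Ordinal hl) (rev_ord p).
by rewrite (@edge_right _ l) ?rev_ordK ?rev_ord4_lt2 -?leqNgt //; apply.
Qed.

Lemma loops_single : loops (twist_state s t) = loops (extend (twist 1) s (t i)).
Proof.
apply: (@n_comp_retract _ _ _ _ of_single to_single sym sym1).
- move=> [[[c|c] p]|[m b]] //=; by rewrite eqxx (ord1 c).
- move=> [[[c|l] p]|[m b]] /=; try exact: connect0.
  case: (eqVneq l i) => [->|li] /=; first exact: connect0.
  exact: connect_port.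
- move=> x y /orP[/eqP->|].
    case xE : (unglue x) (unglueK x) => [u|u] <-; first by
      rewrite edge_outer !to_single_outer -edge_outer; apply: connect1; rewrite /state_step /= eqxx.
    case: u xE => [[[l p]|[[]]]|p] _; first exact: to_single_edge.
    have [l lp] : exists l, edge (tw l p) = port p.
      have [p2|p2] := ltnP p 2.
        have hk : (k.-1 < k)%N by have := ltn_ord i; lia.
        by exists (Ordinal hk); rewrite edge_last //=; lia.
      have hk : (0 < k)%N by have := ltn_ord i; lia.
      by exists (Ordinal hk); rewrite edge_first.
    have pl : edge (port p) = tw l p by rewrite -lp edgeK.
    by have := to_single_edge l p; rewrite sym1 lp -pl.
  case: x => [[[c|l] p]|[m b]] /eqP->.
  + by apply: connect1; rewrite /state_step /= !ffunE eqxx orbT.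
  + rewrite /= ffunE; case: eqVneq => [->|li].
      by apply: connect1; rewrite /state_step /= ffunE eqxx orbT.
    rewrite (t0 li) smoothing_false /twist_port rev_ord4_lt2.
    case: (l < i)%N; case: (p < 2)%N; rewrite /= ?rev_ordK; exact: connect0.
  + by apply: connect1; rewrite /state_step /= eqxx orbT.
- move=> x y /orP[/eqP->|].
    case xE : (unglue x) (unglueK x) => [u|u] <-; first by
      rewrite edge_outer !of_single_outer -edge_outer; exact: edge_e.
    case: u xE => [[[l p]|[[]]]|p] _.
    + by rewrite -/(xdart (inr l) p) (@edge_cross T l p); exact: connect_single.
    + by rewrite (@edge_port T p) sym; exact: connect_single.
  case: x => [[[c|l] p]|[m b]] /eqP->.
  + by apply: connect1; rewrite /state_step /= !ffunE eqxx orbT.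
  + by apply: connect1; rewrite /state_step /= !ffunE eqxx orbT.
  + by apply: connect1; rewrite /state_step /= eqxx orbT.
Qed.

End Single.

Lemma update_twist_state s t i b :
  update (twist_state s t) (inr i : crossing Lk) b = twist_state s (update t i b).
Proof. by apply/ffunP => -[c|l]; rewrite !ffunE. Qed.

Lemma loops_between s t (i j : 'I_k) : (i < j)%N -> t i ->
  (forall l : 'I_k, (i < l)%N -> (l < j)%N -> t l = false) ->
  loops (twist_state s (update t j true)) = (loops (twist_state s (update t j false))).+1.
Proof.
move=> ij ti tij; rewrite -!update_twist_state; apply: loops_update_split => p q p2 q2.
(* Two consecutive positive smoothings close up the strands between them: the darts
   strictly between the cups at i and j form a union of curves. *)
pose position (l : 'I_k) (r : 'I_4) := (l.*2 + (r < 2))%N.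
pose a : pred (darts Lk) := fun x => match x with
  | inl (inr l, r) => (i.*2 < position l r)%N && (position l r <= j.*2)%N
  | _ => false end.
have aE l r : a (tw l r) = (i.*2 < position l r)%N && (position l r <= j.*2)%N by [].
have edge_a l r : a (tw l r) -> a (edge (tw l r)).
  rewrite {1}/a /position; have [r2 /andP[il lj]|r2 /andP[il lj]] := ltnP r 2.
    have hl : (l.+1 < k)%N by have := ltn_ord j; lia.
    by rewrite (@edge_right l (Ordinal hl)) //= /position rev_ord4_lt2 r2 /=; lia.
  have hl : (l.-1 < k)%N by have := ltn_ord l; lia.
  have ll : l = (Ordinal hl).+1 :> nat by rewrite /= prednK //; lia.
  by rewrite (edge_left r2 ll) /= /position rev_ord4_lt2 (ltnNge r) r2 /=; lia.
have acl : closed (cut_step (twist_state s t) (inr j : crossing Lk)) a.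
  apply: (intro_closed (cut_step_sym (twist_state s t) (inr j : crossing Lk))) => x y.
  rewrite -!topredE /=; case: x => [[[c|l] r]|//] //.
  case/orP => [/eqP-> |/andP[lj' /eqP->]]; first exact: edge_a.
  have lj : (l : nat) != j by move: lj'; rewrite (inj_eq (@inr_inj _ _)).
  rewrite !aE ffunE /position; have [li|li] := eqVneq (l : nat) i.
    by rewrite (val_inj li) ti smoothing_true_lt2.
  case/andP => il l_j; rewrite tij ?smoothing_false ?rev_ord4_lt2;
    by case: (r < 2)%N il l_j => /=; lia.
apply/negP => /(closed_connect acl).
rewrite -!topredE /= /position p2 (ltnNge q) q2 /=; lia.
Qed.

(** Each positive smoothing beyond the first closes one curve with the nearest positive one to its
    left. Switching these back leaves a single one, whose position is immaterial by
    [loops_single]. *)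
Lemma loops_twist s t : (0 < #|[set l | t l]|)%N ->
  loops (twist_state s t) = (loops (extend (twist 1) s true) + #|[set l | t l]|.-1)%N.
Proof.
have [n] := ubnP #|[set l | t l]|; elim: n t => // n IH t tn t_gt0.
have [i0] := card_gt0P t_gt0; rewrite inE => ti0.
have [/existsP[[i j] /andP[/andP[ti tj] ij]]|/existsPn none] :=
  boolP [exists u : 'I_k * 'I_k, t u.1 && t u.2 && (u.1 < u.2)%N]; last first.
  have t0 l : l != i0 -> t l = false.
    move=> li; apply/negP => tl; have := none (l, i0); have := none (i0, l) => /=.
    by rewrite tl ti0 /= -!leqNgt => li' il; move: li; rewrite -val_eqE eqn_leq li' il.
  rewrite (loops_single _ t0) ti0; suff -> : #|[set l | t l]| = 1%N by rewrite addn0.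
  by apply/eqP/cards1P; exists i0; apply/setP => l; rewrite !inE; case: eqVneq => [->|/t0].
move: ti tj ij => /= ti tj ij.
have tij : t i && (i < j)%N by rewrite ti ij.
(* [m] is the last positive crossing before [j], so all crossings between them are negative. *)
have [m /andP[tm mj] mmax] := @arg_maxnP _ i (fun l => t l && (l < j)%N) (@nat_of_ord k) tij.
have tE : t = update t j true by apply/ffunP => l; rewrite ffunE; case: eqVneq => [->|].
have card_t : #|[set l | t l]| = #|[set l | update t j false l]|.+1.
  rewrite (cardsD1 j) inE tj add1n; congr _.+1; apply: eq_card => l.
  by rewrite !inE ffunE; case: eqVneq.
have tm' : (0 < #|[set l | update t j false l]|)%N.
  by apply/card_gt0P; exists m; rewrite inE ffunE; case: eqVneq mj => [->|]; rewrite ?ltnn.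
rewrite {1}tE (@loops_between _ _ m) //; last first.
  by move=> l ml lj; apply/negP => tl; have := mmax l; rewrite tl lj => /(_ isT) /(leq_trans ml); rewrite ltnn.
rewrite IH //; last by move: tn; rewrite card_t.
by rewrite card_t -addnS prednK.
Qed.

End TwistStates.

Local Open Scope ring_scope.

(** * State sums *)

Section FieldIdentities.
Variables (K : fieldType) (a : K).
Hypothesis a0 : a != 0.

Definition loop_value : K := - (a ^+ 2 + a ^- 2).

Lemma loop_valueE : loop_value = - (1 + a ^+ 4) / a ^+ 2.
Proof. by rewrite /loop_value; field. Qed.

Lemma loop_value_sqr : a ^+ 2 * loop_value = - a ^+ 4 - 1.
Proof. by rewrite /loop_value; field. Qed.

Lemma loop_value_neq0 : 1 + a ^+ 4 != 0 -> loop_value != 0.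
Proof. by move=> a4; rewrite loop_valueE mulf_neq0 ?oppr_eq0 // invr_eq0 expf_neq0. Qed.

End FieldIdentities.

Section TrueCount.
Variable C : finType.
Implicit Types (s : {ffun C -> bool}) (n : {ffun C -> bool} -> nat).

Definition ntrue s : nat := #|[set c | s c]|.

Lemma ntrue_update s c : ~~ s c -> ntrue (update s c true) = (ntrue s).+1.
Proof.
move=> sc; rewrite /ntrue (cardsD1 c) inE ffunE eqxx add1n; congr _.+1.
by apply: eq_card => d; rewrite !inE ffunE; case: eqVneq => // ->; rewrite (negPf sc).
Qed.

(** [s] is reached from [s0] by switching [ntrue s - ntrue s0] crossings, each adding at most one
    curve. *)
Lemma leq_update n s0 s :
  (forall s c, (n (update s c true) <= (n (update s c false)).+1)%N) ->
  (forall c, s0 c -> s c) -> (n s + ntrue s0 <= n s0 + ntrue s)%N.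
Proof.
move=> nle; have [m] := ubnP (ntrue s); elim: m s => // m IH s sm s0s.
have [/existsP[c /andP[sc s0c]]|/existsPn eq_s] := boolP [exists c, s c && ~~ s0 c]; last first.
  have -> : s = s0; last by [].
  by apply/ffunP => c; have := eq_s c; have := s0s c; case: (s c); case: (s0 c) => // ->.
have sE : s = update (update s c false) c true.
  by apply/ffunP => d; rewrite !ffunE; case: eqVneq => // ->.
have nt : ntrue s = (ntrue (update s c false)).+1.
  by rewrite {1}sE ntrue_update // ffunE eqxx.
have upd : update (update s c false) c false = update s c false.
  by apply/ffunP => d; rewrite !ffunE; case: eqVneq.
have := nle (update s c false) c; rewrite -sE upd.
have := IH (update s c false) _ _.
have s0s' d : s0 d -> update s c false d.
  by move=> s0d; rewrite ffunE; case: eqVneq => [dc|_]; [rewrite dc (negPf s0c) in s0d | exact: s0s].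
have lt : (ntrue (update s c false) < m)%N by move: sm; rewrite nt.
move=> /(_ lt s0s'); rewrite nt; lia.
Qed.

End TrueCount.

Section StateSums.
Variables (K : fieldType) (a : K).
Hypothesis a0 : a != 0.
Variable C : finType.
Local Notation delta := (loop_value a).
Implicit Types (s : {ffun C -> bool}) (n : {ffun C -> bool} -> nat).

Definition weight s : K := \prod_c (if s c then a else a^-1).

Lemma weightE s : weight s = a ^+ (2 * ntrue s) / a ^+ #|C|.
Proof.
have Au : a \is a GRing.unit by rewrite unitfE a0.
rewrite /weight (eq_bigr (fun c => (if s c then a ^+ 2 else 1) * a^-1)); last first.
  by move=> c _; case: (s c); rewrite ?mul1r // expr2 mulrK.
rewrite big_split /= prodr_const -exprVn; congr (_ * _).
by rewrite -big_mkcond /= prodr_const exprM /ntrue cardsE.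
Qed.

(** States are paired by their value at [c]: the positive one contributes [a ^+ 2 * delta] times the
    negative one, and [a ^+ 2 * delta + 1 = - a ^+ 4]. *)
Lemma sum_weight_split n (l : seq C) :
  uniq l ->
  (forall c s, c \in l -> n (update s c true) = (n (update s c false)).+1) ->
  \sum_s weight s * delta ^+ n s
  = (- a ^+ 4) ^+ size l * \sum_(s : {ffun C -> bool} | all (fun c => ~~ s c) l) weight s * delta ^+ n s.
Proof.
elim: l => [|c l IH] /=; first by rewrite mul1r.
move=> /andP[cl ul] nl; rewrite IH //; last by move=> d s dl; apply: nl; rewrite inE dl orbT.
rewrite (exprSr (- a ^+ 4)) -[RHS]mulrA; congr (_ * _); rewrite (bigID (fun s : {ffun C -> bool} => s c)) /=.
have upd s b : all (fun d => ~~ update s c b d) l = all (fun d => ~~ s d) l.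
  by apply: eq_in_all => d dl; rewrite ffunE; case: eqVneq dl cl => // -> ->.
rewrite (reindex_onto (fun s => update s c true) (fun s => update s c false)) /=; last first.
  by move=> s /andP[_ sc]; apply/ffunP => d; rewrite !ffunE; case: eqVneq => // ->.
rewrite (eq_bigl (fun s : {ffun C -> bool} => ~~ s c && all (fun d => ~~ s d) l)); last first.
  move=> s; rewrite upd ffunE eqxx andbT andbC; congr (_ && _).
  apply/eqP/idP => [/ffunP/(_ c)|sc]; first by rewrite !ffunE eqxx => <-.
  by apply/ffunP => d; rewrite !ffunE; case: eqVneq => // ->; rewrite (negPf sc).
rewrite [X in _ + X](eq_bigl (fun s : {ffun C -> bool} => ~~ s c && all (fun d => ~~ s d) l)); last first.
  by move=> s; rewrite andbC.
rewrite -big_split mulr_sumr; apply: eq_bigr => s /andP[sc _] /=.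
have sE : update s c false = s.
  by apply/ffunP => d; rewrite ffunE; case: eqVneq => // ->; rewrite (negPf sc).
rewrite nl ?mem_head // sE.
have -> : weight (update s c true) = a ^+ 2 * weight s.
  by rewrite !weightE ntrue_update // mulnS exprD mulrA.
transitivity (weight s * delta ^+ n s * (a ^+ 2 * delta + 1)); first by rewrite (exprS (loop_value a)); ring.
by rewrite loop_value_sqr //; ring.
Qed.

(** The bound [m] allows a common negative power of [a] to be factored out, leaving a polynomial in
    [a]. *)
Lemma monomial_loop_value (w m e n : nat) : (n <= m + w)%N ->
  a ^+ (2 * w) / a ^+ e * delta ^+ n
  = a ^- (e + 2 * m) * (a ^+ (2 * (m + w - n)) * (- (1 + a ^+ 4)) ^+ n).
Proof.
move=> nm; rewrite loop_valueE // exprMn exprVn -exprM.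
have -> : a ^+ (2 * w) = a ^+ (2 * (m + w - n)) * a ^+ (2 * n) / a ^+ (2 * m).
  rewrite -exprD -mulnDr subnK // mulnDr exprD mulrAC mulfV ?mul1r //.
  by rewrite expf_neq0.
rewrite exprD; move: (a ^+ _) (expf_neq0 (2 * n) a0) (a ^+ _) (a ^+ e) (expf_neq0 e a0)
 (a ^+ (2 * m)) (expf_neq0 (2 * m) a0) => x x0 y z z0 v v0.
by field; rewrite z0 v0 x0.
Qed.

End StateSums.

Lemma A_neq0 : A != 0.
Proof. by rewrite /A tofrac_eq0 polyX_eq0. Qed.

Lemma one_plus_A4_neq0 : 1 + A ^+ 4 != 0.
Proof.
have -> : 1 + A ^+ 4 = tofrac (1 + 'X^4) by rewrite tofracD tofrac1 tofracXn.
rewrite tofrac_eq0; apply/eqP => /(congr1 (fun p : {poly int} => p`_0)).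
by rewrite coefD coef1 coefXn coef0.
Qed.

Definition loop_value_A_neq0 := loop_value_neq0 A_neq0 one_plus_A4_neq0.

Lemma sum_weight_poly (C : finType) n (P : pred {ffun C -> bool}) m :
  (forall s, P s -> (n s <= m + ntrue s)%N) ->
  \sum_(s | P s) weight A s * loop_value A ^+ n s = A ^- (#|C| + 2 * m)
    * tofrac (\sum_(s | P s) 'X^(2 * (m + ntrue s - n s)) * (- (1 + 'X^4)) ^+ n s).
Proof.
move=> nm; rewrite (eq_bigr (fun s => A ^- (#|C| + 2 * m)
    * tofrac ('X^(2 * (m + ntrue s - n s)) * (- (1 + 'X^4)) ^+ n s))).
  by rewrite -mulr_sumr -raddf_sum.
move=> s /nm {}nm; rewrite tofracM !tofracXn tofracN tofracD tofrac1 tofracXn -/A.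
by rewrite (weightE A_neq0) (monomial_loop_value A_neq0 _ nm).
Qed.

(** * Expansion of the twist region *)

Section TwistSum.
Variables (K : fieldType) (a : K) (k : nat).
Hypotheses (a0 : a != 0) (delta0 : loop_value a != 0).
Local Notation delta := (loop_value a).
Implicit Types t : {ffun 'I_k -> bool}.

(** The sum factors over the crossings, and each factor is [- a ^+ 3], the effect of removing a
    kink. *)
Lemma sum_weight_loops : \sum_(t : {ffun 'I_k -> bool}) weight a t * delta ^+ ntrue t = (- a ^+ 3) ^+ k.
Proof.
have kink : a * delta + a^-1 = - a ^+ 3 by rewrite /loop_value; field.
rewrite -kink -[k in RHS]card_ord -prodr_const.
transitivity (\prod_(i < k) \sum_(b : bool) (if b then a * delta else a^-1)); last first.
  by apply: eq_bigr => i _; rewrite big_bool.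
rewrite bigA_distr_bigA; apply: eq_bigr => t _.
have -> : delta ^+ ntrue t = \prod_i (if t i then delta else 1).
  by rewrite -big_mkcond /= prodr_const /ntrue cardsE.
by rewrite -big_split; apply: eq_bigr => i _; case: (t i); rewrite /= ?mulr1.
Qed.

Lemma sum_weight_twist (f : {ffun 'I_k -> bool} -> nat) (n0 ne : nat) :
  f [ffun=> false] = n0 -> (forall t, (0 < ntrue t)%N -> f t = (ne + (ntrue t).-1)%N) ->
  a ^+ k * (\sum_(t : {ffun 'I_k -> bool}) weight a t * delta ^+ f t)
    = delta ^+ n0 + a ^+ 2 * (\sum_(i < k) (- a ^+ 4) ^+ i) * delta ^+ ne.
Proof.
move=> f0 fe; set z := [ffun=> false] in f0.
have wz : weight a z = a ^- k.
  by rewrite /weight (eq_bigr (fun=> a^-1)) ?prodr_const ?card_ord ?exprVn // => i _; rewrite ffunE.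
have tz : ntrue z = 0%N by apply: eq_card0 => i; rewrite !inE ffunE.
(* Multiplication by [delta] turns the exponent [ne + (ntrue t).-1] into [ne + ntrue t], so the
   terms other than [z] are read off from [sum_weight_loops]. *)
apply: (mulfI delta0); rewrite (bigD1 z) //= f0 wz.
have -> : delta * (a ^+ k * (a ^- k * delta ^+ n0 + \sum_(t | t != z) weight a t * delta ^+ f t))
  = delta * delta ^+ n0 + a ^+ k * (\sum_(t | t != z) weight a t * (delta * delta ^+ f t)).
  rewrite (eq_bigr (fun t => delta * (weight a t * delta ^+ f t)) (fun t _ => mulrCA _ _ _)) -mulr_sumr.
  rewrite mulrDr mulVKf ?expf_neq0 // mulrDr.
  by congr (_ + _); rewrite mulrCA.
have -> : \sum_(t | t != z) weight a t * (delta * delta ^+ f t)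
    = \sum_(t | t != z) delta ^+ ne * (weight a t * delta ^+ ntrue t).
  apply: eq_bigr => t tNz; rewrite [RHS]mulrCA; congr (_ * _).
  have t_gt0 : (0 < ntrue t)%N.
    rewrite lt0n; apply: contraNneq tNz => /eqP; rewrite cards_eq0 => /eqP/setP t0.
    by apply/eqP/ffunP => i; rewrite ffunE; have := t0 i; rewrite !inE.
  by rewrite fe // -exprS -exprD -addnS prednK.
have := sum_weight_loops; rewrite (bigD1 z) //= tz expr0 mulr1 wz => /(canRL (addKr _)) sumE.
rewrite -mulr_sumr sumE.
(* The factor [- a ^+ 4 - 1] equals [a ^+ 2 * delta], which supplies the [delta] to be cancelled. *)
have geom := subrX1 (- a ^+ 4) k.
have ak : a ^+ k * (- a ^+ 3) ^+ k = (- a ^+ 4) ^+ k.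
  by rewrite -exprMn mulrN -exprS.
rewrite [RHS]mulrDr; congr (_ + _).
rewrite mulrCA mulrDr ak mulrN mulfV ?expf_neq0 // addrC geom -loop_value_sqr //.
by ring.
Qed.

End TwistSum.

Section Bracket.
Variable T : tangle.
Implicit Types (s : {ffun tcrossing T -> bool}).

(** By [bracket_resolve] these are the curve counts for [L_0] and for [L_e], both read in the one
    diagram [L_ T 1]. *)
Definition loops0 s := loops (extend (twist 1) s false).
Definition loopse s := loops (extend (twist 1) s true).

Lemma bracket_twist k :
  A ^+ k * bracket (L_ T k) = \sum_s weight A s * loop_value A ^+ loops0 s
    + A ^+ 2 * (\sum_(i < k) (- A ^+ 4) ^+ i) * \sum_s weight A s * loop_value A ^+ loopse s.
Proof.
case: k => [|k].
  rewrite big_ord0 mulr0 mul0r addr0 expr0 mul1r.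
  apply: bracket_resolve => [[]//|[]|p].
  rewrite /=; case: insubP => [[] //|_]; congr inr.
  by case: p => -[|[|[|[|p]]]] hp //; apply: val_inj.
rewrite /bracket (reindex (fun u => @twist_state T k.+1 u.1 u.2)) /=; last first.
  exists (fun u : state (L_ T k.+1) => ([ffun c => u (inl c)], [ffun i => u (inr i)])) => [[s t]|u] _ /=.
    by congr (_, _); apply/ffunP => c; rewrite !ffunE.
  by apply/ffunP => -[c|i]; rewrite !ffunE.
rewrite -(pair_bigA _ (fun s t => \prod_c (if @twist_state T k.+1 s t c then A else A^-1)
  * loop_value A ^+ loops (@twist_state T k.+1 s t))) /=.
rewrite !mulr_sumr -big_split; apply: eq_bigr => s _ /=.
rewrite (eq_bigr (fun t => weight A s * (weight A t * loop_value A ^+ loops (@twist_state T k.+1 s t)))); last first.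
  move=> t _; rewrite mulrA; congr (_ * _); rewrite big_sumType /=.
  by congr (_ * _); apply: eq_bigr => c _; rewrite ffunE.
rewrite -mulr_sumr mulrCA [X in _ = _ + X]mulrCA -mulrDr; congr (_ * _).
rewrite -[X in _ + X * _]mulr_sumr; apply: (sum_weight_twist A_neq0 loop_value_A_neq0).
  rewrite (@loops_single T k.+1 ord0) ?ffunE // => l _; by rewrite ffunE.
move=> t t_gt0; exact: loops_twist.
Qed.

End Bracket.

(** * Comparison of the lowest coefficients *)

Lemma shift_exponent (K : fieldType) (a P R : K) (b D k : nat) : a != 0 ->
  a ^+ k * P = (- a ^+ 4) ^+ b * (a ^- D * R) ->
  P = a ^ ((4 * b)%N%:Z - D%:Z - k%:Z) * ((-1) ^+ b * R).
Proof.
move=> a0 kP; apply: (mulfI (expf_neq0 k a0)); rewrite kP (exprNn (a ^+ 4)) -exprM.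
rewrite [RHS]mulrA -[a ^+ k]/(a ^ k%:Z) -expfzDr // addrC subrK expfzDr // -invr_expz.
by rewrite -!exprnP; ring.
Qed.

Lemma geometric_weight (K : fieldType) (a : K) k : a != 0 ->
  1 + a ^+ 2 * loop_value a * (\sum_(i < k) (- a ^+ 4) ^+ i) = (- a ^+ 4) ^+ k.
Proof. by move=> a0; rewrite loop_value_sqr // -subrX1 addrC subrK. Qed.

Section Comparison.
Variables (C : finType) (n0 ne : {ffun C -> bool} -> nat).
Implicit Types (c : C) (s : {ffun C -> bool}).
Local Notation neg := ([ffun=> false] : {ffun C -> bool}).
Hypothesis n0_le : forall s c, (n0 (update s c true) <= (n0 (update s c false)).+1)%N.
Hypothesis ne_le : forall s c, (ne (update s c true) <= (ne (update s c false)).+1)%N.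

(** Both counts have to rise, so that the same crossings can be factored out of both state sums. *)
Definition nugatory c := [forall s,
  (n0 (update s c true) == (n0 (update s c false)).+1)
    && (ne (update s c true) == (ne (update s c false)).+1)].

Hypothesis dichotomy : forall c, nugatory c \/ (n0 (update neg c true) < n0 neg)%N.

Local Notation l := (enum nugatory).
Local Notation off_nugatory := (fun s => all (fun c => ~~ s c) l).
Local Notation m := (n0 neg).
Local Notation E0 := (\sum_s weight A s * loop_value A ^+ n0 s).
Local Notation Ee := (\sum_s weight A s * loop_value A ^+ ne s).

Let ntrue_neg : ntrue neg = 0%N.
Proof. by apply: eq_card0 => c; rewrite !inE ffunE. Qed.

(** Some positive crossing of [s] is not nugatory. Switching it first loses a curve, and every later
    switch gains at most one. *)
Let n0_bound s : off_nugatory s -> s != neg -> (n0 s < m + ntrue s)%N.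
Proof.
move=> s_off s_neg.
have [c sc] : exists c, s c.
  apply/existsP; apply: contraNT s_neg => /existsPn s0; apply/eqP/ffunP => c.
  by rewrite ffunE; apply/negbTE/s0.
have [nc|lt] := dichotomy c.
  by move/allP: s_off => /(_ c); rewrite mem_enum => /(_ nc); rewrite sc.
have sub d : update neg c true d -> s d by rewrite !ffunE; case: eqVneq => [->|].
have := leq_update n0_le sub; rewrite ntrue_update ?ffunE // ntrue_neg; lia.
Qed.

(** What remains of [E0] once the nugatory crossings are summed out and a power of [A] is
    removed. *)
Definition leading_poly : {poly int} :=
  \sum_(s | off_nugatory s) 'X^(2 * (m + ntrue s - n0 s)) * (- (1 + 'X^4)) ^+ n0 s.

(** Only the all-negative state has a constant term; in the others [n0_bound] leaves a positive
    power of ['X]. *)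
Lemma leading_poly_coef0 : leading_poly.[0] = (-1) ^+ m.
Proof.
have neg_off : off_nugatory neg by apply/allP => c _; rewrite ffunE.
rewrite /leading_poly horner_sum (bigD1 neg) //= big1 => [|s /andP[s_off s_neg]].
  by rewrite ntrue_neg addn0 subnn !hornerE.
have lt := n0_bound s_off s_neg.
by rewrite hornerM hornerXn expr0n muln_eq0 subn_eq0 leqNgt lt mul0r.
Qed.

Lemma leading_polyE :
  E0 = (- A ^+ 4) ^+ size l * (A ^- (#|C| + 2 * m) * tofrac leading_poly).
Proof.
rewrite (sum_weight_split A_neq0 (l := l) (enum_uniq _)) => [|c s]; last first.
  by rewrite mem_enum => /forallP/(_ s)/andP[/eqP].
congr (_ * _); apply: sum_weight_poly => s s_off.
have sub d : neg d -> s d by rewrite ffunE.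
by have := leq_update n0_le sub; rewrite ntrue_neg addn0.
Qed.

(** Here [Ee] is [loop_value A] times [E0] and the geometric sum telescopes, so both coefficient
    lists are those of [leading_poly] up to sign, with opposite signs for [j.+1] and [j]. *)
Lemma doteq_nugatory j P Q : (forall s, ne s = (n0 s).+1) ->
  A ^+ j.+1 * P = E0 + A ^+ 2 * (\sum_(i < j.+1) (- A ^+ 4) ^+ i) * Ee ->
  A ^+ j * Q = E0 + A ^+ 2 * (\sum_(i < j) (- A ^+ 4) ^+ i) * Ee ->
  doteq (4 * j.+1) P Q.
Proof.
move=> neE.
have EeE : Ee = loop_value A * E0.
  by rewrite mulr_sumr; apply: eq_bigr => s _; rewrite neE exprS mulrCA.
have E k : E0 + A ^+ 2 * (\sum_(i < k) (- A ^+ 4) ^+ i) * Ee =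
    (- A ^+ 4) ^+ (k + size l) * (A ^- (#|C| + 2 * m) * tofrac leading_poly).
  rewrite (exprD _ k) -[RHS]mulrA -leading_polyE -(geometric_weight k A_neq0) EeE mulrDl mul1r.
  by congr (_ + _); rewrite mulrA (mulrAC (A ^+ 2)).
rewrite !E => /(shift_exponent A_neq0) PE /(shift_exponent A_neq0) QE.
pose r k : {poly int} := (-1) ^+ k * leading_poly.
have rE k : tofrac (r k) = (-1) ^+ k * tofrac leading_poly.
  by rewrite tofracM tofracXn tofracN tofrac1.
have r0 k : (r k)`_0 != 0.
  by rewrite -horner_coef0 hornerM leading_poly_coef0 !hornerE -exprD signr_eq0.
exists (r (j.+1 + size l)%N), (r (j + size l)%N); split.
- by split=> //; eexists; rewrite rE; exact: PE.
- by split=> //; eexists; rewrite rE; exact: QE.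
exists true => i _; rewrite expr1 mulN1r -coefN /r addSn exprS.
by rewrite mulN1r mulNr.
Qed.

Lemma doteq_reduced j P Q : (ne neg < m)%N ->
  A ^+ j.+1 * P = E0 + A ^+ 2 * (\sum_(i < j.+1) (- A ^+ 4) ^+ i) * Ee ->
  A ^+ j * Q = E0 + A ^+ 2 * (\sum_(i < j) (- A ^+ 4) ^+ i) * Ee ->
  doteq (4 * j.+1) P Q.
Proof.
move=> ne_neg.
(* Since [ne neg < m], the bound [m.-1] serves in place of [m]; this is the extra factor [A ^+ 2] in
   [EeE], and with the one already before [Ee] it makes the ['X^4] of [r]. *)
pose qe : {poly int} :=
  \sum_(s | off_nugatory s) 'X^(2 * (m.-1 + ntrue s - ne s)) * (- (1 + 'X^4)) ^+ ne s.
have EeE : Ee = (- A ^+ 4) ^+ size l * (A ^- (#|C| + 2 * m) * (A ^+ 2 * tofrac qe)).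
  rewrite (sum_weight_split A_neq0 (l := l) (enum_uniq _)) => [|c s]; last first.
    by rewrite mem_enum => /forallP/(_ s)/andP[_ /eqP].
  congr (_ * _); rewrite (@sum_weight_poly _ _ _ m.-1) => [|s s_off].
    rewrite mulrA; congr (_ * _).
    have -> : (#|C| + 2 * m = #|C| + 2 * m.-1 + 2)%N by lia.
    by rewrite (exprD _ (#|C| + 2 * m.-1) 2) invfM mulfVK // expf_neq0 // A_neq0.
  have sub d : neg d -> s d by rewrite ffunE.
  have := leq_update ne_le sub; rewrite ntrue_neg addn0; lia.
pose g k : {poly int} := \sum_(i < k) (- 'X^4) ^+ i.
have gE k : tofrac (g k) = \sum_(i < k) (- A ^+ 4) ^+ i.
  rewrite (eq_bigr (fun i : 'I_k => tofrac ((- 'X^4) ^+ i))); first by rewrite -raddf_sum.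
  by move=> i _; rewrite tofracXn tofracN tofracXn.
pose r k : {poly int} := leading_poly + 'X^4 * (g k * qe).
have E k : E0 + A ^+ 2 * (\sum_(i < k) (- A ^+ 4) ^+ i) * Ee =
    (- A ^+ 4) ^+ size l * (A ^- (#|C| + 2 * m) * tofrac (r k)).
  rewrite leading_polyE EeE -gE tofracD (tofracM 'X^4) (tofracM (g k)) tofracXn -/A.
  have fact (K : fieldType) (x y z w t u v : K) :
    x * (y * z) + w ^+ 2 * t * (x * (y * (w ^+ 2 * u))) = x * (y * (z + w ^+ 4 * (t * u))) by ring.
  exact: fact.
rewrite !E => /(shift_exponent A_neq0) PE /(shift_exponent A_neq0) QE.
pose r' k : {poly int} := (-1) ^+ size l * r k.
have r'E k : tofrac (r' k) = (-1) ^+ size l * tofrac (r k).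
  by rewrite tofracM tofracXn tofracN tofrac1.
have r'0 k : (r' k)`_0 != 0.
  rewrite -horner_coef0 /r' /r hornerM hornerD leading_poly_coef0 hornerM hornerXn mul0r addr0.
  by rewrite !hornerE -exprD signr_eq0.
exists (r' j.+1), (r' j); split.
- by split=> //; eexists; rewrite r'E; exact: PE.
- by split=> //; eexists; rewrite r'E; exact: QE.
exists false => i ij; rewrite expr0 mul1r.
(* The new term of the geometric sum has degree [4 * j]; with the factor ['X^4] it starts at degree
   [4 * j.+1]. *)
have -> : r' j.+1 = r' j + 'X^(4 * j.+1) * ((-1) ^+ (size l + j) * qe).
  rewrite /r' /r /g big_ord_recr /= mulnS exprD exprM (exprNn ('X^4)) exprD; ring.
by rewrite coefD coefXnM ij addr0.
Qed.

End Comparison.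

(** * Curve counts for [L_0] and [L_e] as states of the given diagram *)

Section Twisting.
Variables (T : tangle) (k : nat).
Implicit Types (s : {ffun tcrossing T -> bool}) (t : {ffun 'I_k.+1 -> bool}).

Lemma update_twist_state_outer s t c b :
  update (twist_state s t) (inl c : crossing (L_ T k.+1)) b = twist_state (update s c b) t.
Proof. by apply/ffunP => -[d|l]; rewrite !ffunE. Qed.

Definition all_negative : {ffun 'I_k.+1 -> bool} := [ffun=> false].
Definition first_positive : {ffun 'I_k.+1 -> bool} := update all_negative ord0 true.

(** This transfers the count to [L_ T k.+1], the diagram assumed planar and alternating. *)
Lemma loops0E s : loops0 s = loops (twist_state s all_negative).
Proof. by rewrite (@loops_single T k.+1 ord0) ?ffunE // => l _; rewrite ffunE. Qed.

Lemma loopseE s : loopse s = loops (twist_state s first_positive).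
Proof.
rewrite (@loops_single T k.+1 ord0); first by rewrite ffunE eqxx.
by move=> l /negPf l0; rewrite !ffunE l0.
Qed.

End Twisting.

Theorem theorem3p4 (T : tangle) (k : nat) :
  (1 <= k)%N ->
  planar (L_ T k) ->
  alternating (L_ T k) ->
  maximal_negative_twist_region (marked_region T k) ->
  doteq (4 * k) (bracket (L_ T k)) (bracket (L_ T k.-1)).
Proof.
case: k => // k _ pl alt _ /=.
pose neg : {ffun tcrossing T -> bool} := [ffun=> false].
have loops0E := @loops0E T k; have loopseE := @loopseE T k.
have neg0 c : twist_state neg (all_negative k) c = false by rewrite ffunE; case: c => c; rewrite ffunE.
have le0 (s : {ffun tcrossing T -> bool}) c : (loops0 (update s c true) <= (loops0 (update s c false)).+1)%N.
  by rewrite !loops0E -!update_twist_state_outer loops_update_le.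
have lee (s : {ffun tcrossing T -> bool}) c : (loopse (update s c true) <= (loopse (update s c false)).+1)%N.
  by rewrite !loopseE -!update_twist_state_outer loops_update_le.
have dich c : nugatory (@loops0 T) (@loopse T) c \/ (loops0 (update neg c true) < loops0 neg)%N.
  case: (crossing_dichotomy alt (inl c) pl neg0) => [nug|lt]; [left|right].
    (* [nug] holds in every state, hence with the region all negative and with its first crossing
       positive. *)
    apply/forallP => s; rewrite !loops0E !loopseE -!update_twist_state_outer.
    by apply/andP; split; apply/eqP; exact: nug.
  by rewrite !loops0E -update_twist_state_outer.
have all_negativeE : update (all_negative k) ord0 false = all_negative k.
  by apply/ffunP => i; rewrite !ffunE; case: ifP.
have PE := bracket_twist T k.+1; have QE := bracket_twist T k.
(* The first crossing of the region decides: either [loopse] is always [loops0] plus one, or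
   [loopse neg < loops0 neg]. *)
case: (crossing_dichotomy alt (inr ord0) pl neg0) => [nug|lt].
  apply: doteq_nugatory le0 dich _ _ _ _ PE QE => s.
  by rewrite loops0E loopseE /first_positive -update_twist_state nug update_twist_state all_negativeE.
apply: doteq_reduced le0 lee dich _ _ _ _ PE QE.
by rewrite loops0E loopseE /first_positive -update_twist_state.
Qed.
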